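(* Thompson's group $F$ has a $3$-generated maximal subgroup of infinite index which acts transitively on the set of finite dyadic fractions $\mathcal D=\mathbb{Z}[\frac12]\cap(0,1)$.
   Context: Thompson's group $F$ is the group of all piecewise-linear increasing homeomorphisms of $[0,1]$ with finitely many breakpoints, all in $\mathbb{Z}[\frac12]\cap(0,1)$, and all slopes integer powers of $2$. *)

(* Defs.v *)
From HB Require Import structures.
From mathcomp Require Import all_boot all_order all_algebra.
From mathcomp Require Import ring lra.
From mathcomp Require Import all_classical all_reals all_analysis.

Set Implicit Arguments.
Unset Strict Implicit.
Unset Printing Implicit Defensive.

Import Order.TTheory GRing.Theory Num.Theory.
Import numFieldNormedType.Exports.

Local Open Scope classical_set_scope.
Local Open Scope ring_scope.

(* As a type, [I01 R] is the subtype [{x : R | x \in I01 R}] with its induced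
   topology. *)
Definition I01 (R : realType) : set R := [set x | 0 <= x <= 1].
Arguments I01 : clear implicits.

Section Homeomorphisms.
Variable R : realType.
Implicit Types (f g : I01 R -> I01 R) (x : I01 R).

Definition homeomorphism f : Prop :=
  continuous f /\ exists g, [/\ cancel f g, cancel g f & continuous g].

Definition increasing f : Prop :=
  forall x y : I01 R, \val x < \val y -> \val (f x) < \val (f y).

Definition is_dyadic (r : R) : Prop :=
  exists (m : int) (n : nat), r = m%:~R / 2 ^+ n.

Definition dyadic_fractions : set (I01 R) :=
  [set x | is_dyadic (\val x) /\ 0 < \val x < 1].

(* All breakpoints of [f] are in [s], which may also list other points; no
   order on [s] is needed. *)
Definition dyadic_piecewise_linear f : Prop :=
  exists2 s : seq (I01 R), [set` s] `<=` dyadic_fractions &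
    forall a b : I01 R, \val a < \val b ->
      (forall t, t \in s -> ~ (\val a < \val t < \val b)) ->
      exists (k : int) (c : R), forall x,
        \val a <= \val x <= \val b -> \val (f x) = 2 ^ k * \val x + c.

Definition in_thompsonF f : Prop :=
  [/\ homeomorphism f, increasing f & dyadic_piecewise_linear f].

End Homeomorphisms.

Record thompsonF (R : realType) := ThompsonF {
  thompsonF_fun :> I01 R -> I01 R;
  thompsonFP : in_thompsonF thompsonF_fun }.

Section ThompsonGroup.
Variable R : realType.
Implicit Types (f g : I01 R -> I01 R) (x : I01 R).

Lemma thompsonF_eq (f g : thompsonF R) : f =1 g -> f = g.
Proof.
case: f g => [f fF] [g gF] /= /funext fg.
by case: _ / fg in gF *; congr ThompsonF; exact: Prop_irrelevance.
Qed.

Lemma I01P x : 0 <= \val x <= 1.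
Proof. by case: x => r /=; rewrite inE. Qed.

Lemma zero_in_I01 : (0 : R) \in I01 R.
Proof. by rewrite inE /I01 /= lexx ler01. Qed.

Lemma one_in_I01 : (1 : R) \in I01 R.
Proof. by rewrite inE /I01 /= lexx ler01. Qed.

Definition zeroI : I01 R := exist _ 0 zero_in_I01.
Definition oneI : I01 R := exist _ 1 one_in_I01.

Lemma increasing_lt f x y : increasing f ->
  (\val (f x) < \val (f y)) = (\val x < \val y).
Proof.
move=> fI; apply/idP/idP; last exact: fI.
rewrite ltNge; case: (ltgtP (\val x) (\val y)) => // [/fI|/val_inj->].
  by move/ltW->.
by rewrite lexx.
Qed.

Lemma increasing_le f x y : increasing f ->
  (\val (f x) <= \val (f y)) = (\val x <= \val y).
Proof. by move=> fI; rewrite !leNgt increasing_lt. Qed.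

Lemma increasing0 f g : increasing f -> cancel g f -> f zeroI = zeroI.
Proof.
move=> fI gK; apply: val_inj; apply/eqP; rewrite eq_le.
rewrite -{2}(gK zeroI) increasing_le //.
by case/andP: (I01P (g zeroI)) => -> _; case/andP: (I01P (f zeroI)) => ->.
Qed.

Lemma increasing1 f g : increasing f -> cancel g f -> f oneI = oneI.
Proof.
move=> fI gK; apply: val_inj; apply/eqP; rewrite eq_le.
rewrite -{3}(gK oneI) increasing_le //.
by case/andP: (I01P (g oneI)) => _ ->; case/andP: (I01P (f oneI)) => _ ->.
Qed.

Lemma increasing_can f g : increasing f -> cancel g f -> increasing g.
Proof. by move=> fI gK x y xy; rewrite -(increasing_lt _ _ fI) !gK. Qed.

Lemma is_dyadicB (r s : R) : is_dyadic r -> is_dyadic s -> is_dyadic (r - s).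
Proof.
move=> [m [n ->]] [p [q ->]].
exists (m * 2 ^+ q - p * 2 ^+ n), (n + q)%N.
rewrite rmorphB !rmorphM !rmorphXn /= exprD.
by field; rewrite !expf_neq0.
Qed.

Lemma is_dyadic0 : is_dyadic (0 : R).
Proof. by exists 0, 0%N; rewrite mul0r. Qed.

Lemma is_dyadicD (r s : R) : is_dyadic r -> is_dyadic s -> is_dyadic (r + s).
Proof.
move=> dr ds; rewrite -[s]opprK -[- s]sub0r.
exact/is_dyadicB/is_dyadicB/ds/is_dyadic0.
Qed.

Lemma is_dyadicZ (k : int) (r : R) : is_dyadic r -> is_dyadic (2 ^ k * r).
Proof.
move=> [m [n ->]]; case: k => k.
  exists (m * 2 ^+ k), n; rewrite rmorphM rmorphXn /=.
  by rewrite -exprnP; ring.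
exists m, (k.+1 + n)%N; rewrite NegzE -exprz_inv exprD.
by rewrite -exprnP exprVn invfM; ring.
Qed.

Lemma previous_breakpoint (s : seq (I01 R)) x : 0 < \val x ->
  exists t, [/\ t \in zeroI :: s, \val t < \val x &
    forall u, u \in s -> ~ (\val t < \val u < \val x)].
Proof.
move=> x0; elim: s => [|u s [t [ts tx tP]]].
  by exists zeroI; split; rewrite ?mem_head.
have [/andP[tu ux]|tu] := boolP (\val t < \val u < \val x).
  exists u; split=> // [|v]; first by rewrite !inE eqxx orbT.
  rewrite inE => /orP[/eqP->|vs]; first by rewrite ltxx.
  by move=> /andP[uv vx]; apply: (tP v vs); rewrite (lt_trans tu uv).
exists t; split=> // [|v].
  by move: ts; rewrite !inE => /orP[->|->]; rewrite ?orbT.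
by rewrite inE => /orP[/eqP->|/tP//]; apply/negP.
Qed.

Lemma thompsonF_dyadic f x : in_thompsonF f ->
  is_dyadic (\val (f x)) <-> is_dyadic (\val x).
Proof.
move=> [[_ [g [_ gK _]]] fI [s sD sP]].
have f0 := increasing0 fI gK.
pose m (x : I01 R) := count (fun t : I01 R => \val t < \val x) s.
have [n] := ubnP (m x); elim: n x => // n IHn x mx.
have [x0|x0] := leP (\val x) 0.
  suff -> : x = zeroI by rewrite f0.
  by apply: val_inj; apply/eqP; rewrite eq_le x0; case/andP: (I01P x).
have [t [ts tx tP]] := previous_breakpoint s x0.
have [k [c fE]] := sP _ _ tx tP.
have ft : \val (f t) = 2 ^ k * \val t + c by apply: fE; rewrite lexx ltW.
have fx : \val (f x) = 2 ^ k * \val x + c by apply: fE; rewrite lexx ltW.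
have fxE : \val (f x) = 2 ^ k * (\val x - \val t) + \val (f t).
  by rewrite fx ft //; ring.
have [dt dft] : is_dyadic (\val t) /\ is_dyadic (\val (f t)).
  move: ts; rewrite inE => /orP[/eqP->|ts].
    by rewrite f0; split; exact: is_dyadic0.
  have [dt _] := sD _ ts; split=> //; apply/IHn => //.
  apply: leq_trans (_ : (m t < m x)%N) _; last by rewrite -ltnS.
  have := count_predUI (fun u : I01 R => \val u < \val t) (pred1 t) s.
  rewrite (@eq_count _ (predI _ _) pred0) => [|u /=]; last first.
    by apply/negP => /andP[ut /eqP ue]; rewrite ue ltxx in ut.
  rewrite count_pred0 addn0 => mE.
  have : (m t + count (pred1 t) s <= m x)%N.
    rewrite -mE; apply: sub_count => u /= /orP[ut|/eqP->//].
    exact: lt_trans ut tx.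
  apply: leq_trans; rewrite -[X in (X < _)%N]addn0 ltn_add2l -has_count has_pred1 //.
split=> [dfx|dx]; last by rewrite fxE; apply/is_dyadicD/dft/is_dyadicZ/is_dyadicB.
have -> : \val x = 2 ^ (- k) * (\val (f x) - \val (f t)) + \val t.
  rewrite fxE addrK mulrA -expfzDr // addNr expr0z.
  by ring.
by apply/is_dyadicD/dt/is_dyadicZ/is_dyadicB.
Qed.

Lemma thompsonF_dyadic_fractions f x : in_thompsonF f ->
  dyadic_fractions (f x) <-> dyadic_fractions x.
Proof.
move=> fF; have [[_ [g [_ gK _]]] fI _] := fF.
have f_gt0 : (0 < \val (f x)) = (0 < \val x).
  by rewrite -(increasing_lt zeroI x fI) (increasing0 fI gK).
have f_lt1 : (\val (f x) < 1) = (\val x < 1).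
  by rewrite -(increasing_lt x oneI fI) (increasing1 fI gK).
rewrite /dyadic_fractions /mkset f_gt0 f_lt1.
by split=> -[dx x01]; split=> //; apply/(thompsonF_dyadic x fF).
Qed.

Lemma in_thompsonF_id : in_thompsonF (@id (I01 R)).
Proof.
split=> //.
  by split; [|exists id; split=> //]; move=> x; exact: cvg_id.
exists [::] => // a b _ _; exists 0, 0 => x _.
by rewrite expr0z mul1r addr0.
Qed.

Lemma in_thompsonF_can f g :
  in_thompsonF f -> cancel f g -> cancel g f -> in_thompsonF g.
Proof.
move=> fF fK gK; have [[fC [g' [fK' gK' gC]]] fI [s sD sP]] := fF.
have gE : g' = g by apply/funext => y; rewrite -{1}(gK y) fK'.
rewrite {}gE in gC {fK' gK'}.
have gI := increasing_can fI gK.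
split=> //; first by split=> //; exists f.
exists (map f s) => [_ /= /mapP[t ts ->]|a b ab abP].
  by apply/(thompsonF_dyadic_fractions t fF)/sD.
have [|t ts|k [c fE]] := sP (g a) (g b); first exact: gI.
  move=> /andP[gat tgb]; apply: (abP (f t)); first exact: map_f.
  by rewrite -{1}(gK a) -{1}(gK b) !increasing_lt // gat.
exists (- k), (- (2 ^ (- k) * c)) => y ayb.
have := fE (g y); rewrite !increasing_le // gK => /(_ ayb) ->.
have k1 : (2 : R) ^ (- k) * 2 ^ k = 1 by rewrite -expfzDr // addNr expr0z.
by rewrite mulrDr mulrA k1; ring.
Qed.

Lemma in_thompsonF_comp f g :
  in_thompsonF f -> in_thompsonF g -> in_thompsonF (f \o g).
Proof.
move=> fF gF; have [[fC [f' [fK fK' fC']]] fI [s sD sP]] := fF.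
have [[gC [g' [gK gK' gC']]] gI [u uD uP]] := gF.
split.
- split=> [x|]; first exact: continuous_comp (gC x) (fC (g x)).
  exists (g' \o f'); split; [exact: can_comp|exact: can_comp|].
  by move=> x; exact: continuous_comp (fC' x) (gC' (f' x)).
- by move=> x y xy; exact/fI/gI.
exists (u ++ map g' s) => [t /=|a b ab abP].
  rewrite mem_cat => /orP[/uD//|/mapP[v vs ->]].
  by apply/(thompsonF_dyadic_fractions (g' v) gF); rewrite gK'; exact: sD.
have [//|t tu|k [c gE]] := uP a b.
  by apply: abP; rewrite mem_cat tu.
have [|t ts|l [d fE]] := sP (g a) (g b); first exact: gI.
  move=> /andP[gat tgb]; apply: (abP (g' t)); first by rewrite mem_cat map_f ?orbT.
  by rewrite -(increasing_lt a (g' t) gI) -(increasing_lt (g' t) b gI) gK' gat.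
exists (l + k), (2 ^ l * c + d) => x axb.
have -> : \val ((f \o g) x) = 2 ^ l * \val (g x) + d.
  by apply: fE; rewrite !increasing_le.
have lk : (2 : R) ^ (l + k) = 2 ^ l * 2 ^ k by rewrite expfzDr.
by rewrite gE // lk; ring.
Qed.

Lemma thompsonF_inv_subproof (f : thompsonF R) :
  exists g : I01 R -> I01 R, cancel f g /\ cancel g f.
Proof. by have [[_ [g [? ? _]]] _ _] := thompsonFP f; exists g. Qed.

Definition thompsonF_inv_fun (f : thompsonF R) : I01 R -> I01 R :=
  projT1 (cid (thompsonF_inv_subproof f)).

Lemma thompsonF_funK (f : thompsonF R) : cancel f (thompsonF_inv_fun f).
Proof. by rewrite /thompsonF_inv_fun; case: cid => g []. Qed.

Lemma thompsonF_invK (f : thompsonF R) : cancel (thompsonF_inv_fun f) f.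
Proof. by rewrite /thompsonF_inv_fun; case: cid => g []. Qed.

Definition thompsonF_one : thompsonF R := ThompsonF in_thompsonF_id.

Definition thompsonF_mul (f g : thompsonF R) : thompsonF R :=
  ThompsonF (in_thompsonF_comp (thompsonFP f) (thompsonFP g)).

Definition thompsonF_inv (f : thompsonF R) : thompsonF R :=
  ThompsonF (in_thompsonF_can (thompsonFP f)
    (thompsonF_funK f) (thompsonF_invK f)).

Lemma thompsonF_mulA : associative thompsonF_mul.
Proof. by move=> f g h; apply: thompsonF_eq. Qed.

Lemma thompsonF_mul1 : left_id thompsonF_one thompsonF_mul.
Proof. by move=> f; apply: thompsonF_eq. Qed.

Lemma thompsonF_mulr1 : right_id thompsonF_one thompsonF_mul.
Proof. by move=> f; apply: thompsonF_eq. Qed.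

Lemma thompsonF_mulV : left_inverse thompsonF_one thompsonF_inv thompsonF_mul.
Proof. by move=> f; apply: thompsonF_eq => x /=; rewrite thompsonF_funK. Qed.

Lemma thompsonF_mulrV : right_inverse thompsonF_one thompsonF_inv thompsonF_mul.
Proof. by move=> f; apply: thompsonF_eq => x /=; rewrite thompsonF_invK. Qed.

End ThompsonGroup.

HB.instance Definition _ (R : realType) := gen_eqMixin (thompsonF R).
HB.instance Definition _ (R : realType) := gen_choiceMixin (thompsonF R).
HB.instance Definition _ (R : realType) := isGroup.Build (thompsonF R)
  (@thompsonF_mulA R) (@thompsonF_mul1 R) (@thompsonF_mulr1 R)
  (@thompsonF_mulV R) (@thompsonF_mulrV R).

Lemma thompsonF_mulE (R : realType) (f g : thompsonF R) :
  thompsonF_fun (f * g)%g = f \o g.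
Proof. by []. Qed.

Section Subgroups.
Variable G : groupType.
Implicit Types (H K A : set G).

Definition subgroup H : Prop := group_closed (mem H).

Lemma subgroupP H :
  subgroup H <-> H 1%g /\ forall x y, H x -> H y -> H (x * y^-1)%g.
Proof.
split=> -[H1 HB]; split; first exact: set_mem.
- by move=> x y Hx Hy; apply/set_mem/HB; exact: mem_set.
- exact: mem_set.
- by move=> x y /set_mem Hx /set_mem Hy; apply/mem_set/HB.
Qed.

Definition subgroup_generated A : set G := smallest subgroup A.

(* [n] elements suffice; repetitions are allowed, so [n] need not be minimal. *)
Definition n_generated (n : nat) H : Prop :=
  exists s : n.-tuple G, H = subgroup_generated [set` s].

Definition maximal_subgroup H : Prop :=
  [/\ subgroup H, H `<` setT &
      forall K, subgroup K -> H `<=` K -> K = H \/ K = setT].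

Definition left_coset (g : G) H : set G := [set (g * h)%g | h in H].

Definition infinite_index H : Prop :=
  infinite_set (range (fun g : G => left_coset g H)).

End Subgroups.

Definition acts_transitively_on (R : realType) (H : set (thompsonF R))
    (X : set (I01 R)) : Prop :=
  forall x, X x -> [set (h : thompsonF R) x | h in H] = X.

(* Main.v *)
Require Import Defs.
From mathcomp Require Import all_boot all_order all_algebra.
From mathcomp Require Import zify ring lra.
From mathcomp Require Import all_classical all_reals all_analysis.

Set Implicit Arguments.
Unset Strict Implicit.
Unset Printing Implicit Defensive.

Import Order.TTheory GRing.Theory Num.Theory.
Import numFieldNormedType.Exports.

Local Open Scope classical_set_scope.
Local Open Scope ring_scope.

(** A word [u] in two letters names a dyadic interval, onto which [cone u] maps
    [0,1] affinely, and [maps f u v] says that [f] carries the interval of [u]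
    affinely onto that of [v]. An element of F is determined by the leaves of two binary trees
    that it matches in this way ([tree_pair]).

    The maximal subgroup is defined by a colouring of dyadic intervals. A finite
    automaton reads words: the halves of an interval of state l, a, b, c have
    states (l, a), (a, b), (a, c), (b, b) respectively. Intervals ending at 1
    get no state, those starting at 0 (and not ending at 1) get l, and the
    others are inner intervals, of state a, b or c. The subgroup [colored]
    consists of the elements of F that never carry an interval to one of
    another state.

    Three generators. The rotation x(yz) -> (xy)z of an interval of state b
    onto itself turns b into a: the three pieces of b -> (a, (b, b)) and of
    a -> ((a, b), b) have the same states. Applying it to the left half turns
    c into a. Hence, up to these recolourings, every partition of [0,1] has
    its inner intervals of state a, and the elementary subdivision of an
    interval of state q becomes an element [split_state q k] of the group, k
    being the position of the interval in the partition. A tree is a product of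
    elementary subdivisions, so these elements generate. Conjugation by
    [split_state Sl 0] shifts k, and the elements for c coincide with those for
    a; the elements for l, a and b at the first possible position remain
    ([colored_generated]).

    Maximality. Any two inner intervals of equal state are exchanged by
    the subgroup ([joined_same_state]). Let K be a subgroup properly containing
    it. Some k in K carries an interval to one of a different inner state, and
    passing to halves repeatedly identifies all three states: the automaton has
    no proper quotient. So K carries any inner interval to any other one
    ([joined_inner]), and whatever [colored] does inside one inner interval, K
    does inside all of them. On an interval of state a, [colored] contains the
    rebracketing x((yz)(uv)) -> (x(y(zu)))v, and on one of state b it contains
    x(((yz)(uv))w) -> (x(y(zu)))(vw). Together they yield the associativity law
    ([laws_give_rotation]), that is, K contains rotations in inner intervals;
    dividing one of them out of [split_state Sa 1] leaves a plain subdivision,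
    and with [split_state Sl 0] this generates all of F ([K_full]).

    Transitivity follows because every inner interval is carried, up to
    recolouring, onto [1/2, 3/4], so that every dyadic fraction, being the
    middle of a dyadic interval, can be moved to 1/2 ([to_middle]). The index is
    infinite because rotations in disjoint intervals of state a lie in distinct
    cosets ([colored_infinite_index]). *)

(** * Dyadic intervals and the pairs of them matched by an element of F *)

Section Cones.
Variable R : realType.
Implicit Types (x y : I01 R) (b : bool) (u v w : seq bool).

Lemma halve_in_I01 b x : (b%:R + \val x) / 2 \in I01 R.
Proof. by rewrite inE /I01 /=; have /= := I01P x; case: b => /=; lra. Qed.

Definition halve b x : I01 R := exist _ ((b%:R + \val x) / 2) (halve_in_I01 b x).

Definition cone u x : I01 R := foldr halve x u.

Lemma cone_cat u v x : cone (u ++ v) x = cone u (cone v x).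
Proof. exact: foldr_cat. Qed.

Lemma halve_inj b : injective (halve b).
Proof.
move=> x y /(congr1 \val) /= e; apply: val_inj => /=; lra.
Qed.

Lemma halve01 : halve false (oneI R) = halve true (zeroI R).
Proof. by apply: val_inj => /=; rewrite add0r addr0. Qed.

Lemma halve00 : halve false (zeroI R) = zeroI R.
Proof. by apply: val_inj => /=; lra. Qed.

Lemma halve11 : halve true (oneI R) = oneI R.
Proof. by apply: val_inj => /=; lra. Qed.

Lemma halve_surj x : exists b y, x = halve b y.
Proof.
have /= xP := I01P x.
have [/= x2|/= x2] := leP (\val x) (1/2).
  have y01 : 2 * \val x \in I01 R by rewrite inE /I01 /=; lra.
  exists false, (exist (fun z : R => z \in I01 R) _ y01); apply: val_inj => /=; lra.
have y01 : 2 * \val x - 1 \in I01 R by rewrite inE /I01 /=; lra.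
exists true, (exist (fun z : R => z \in I01 R) _ y01); apply: val_inj => /=; lra.
Qed.

Lemma cone0_eq0 u : cone u (zeroI R) = zeroI R -> u = nseq (size u) false.
Proof.
elim: u => [|b u IH] //= e; have := congr1 \val e => /= e'.
have /= := I01P (cone u (zeroI R)); case: b e e' => e /= e' P; first by (clear IH e; exfalso; lra).
rewrite -IH //; apply: val_inj => /=; clear IH e; lra.
Qed.

Lemma cone1_eq1 u : cone u (oneI R) = oneI R -> u = nseq (size u) true.
Proof.
elim: u => [|b u IH] //= e; have := congr1 \val e => /= e'.
have /= := I01P (cone u (oneI R)); case: b e e' => e /= e' P; last by (clear IH e; exfalso; lra).
rewrite -IH //; apply: val_inj => /=; clear IH e; lra.
Qed.

Lemma cone_onto u : cone u (zeroI R) = zeroI R -> cone u (oneI R) = oneI R -> u = [::].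
Proof. by move=> /cone0_eq0 -> /cone1_eq1; case: (size u). Qed.

Lemma cone_lt u x y : (\val (cone u x) < \val (cone u y)) = (\val x < \val y).
Proof.
elim: u => //= b u <-.
by rewrite ltr_pM2r ?invr_gt0 ?ltr0n // ltrD2l.
Qed.

Lemma cone_determines u v : cone u =1 cone v -> u = v.
Proof.
elim: u v => [|b u IH] [|c v] //= e.
- by symmetry; apply: cone_onto; rewrite -e.
- by apply: cone_onto; rewrite e.
have bc : b = c.
  clear IH.
  have e0 := congr1 \val (e (zeroI R)); have e1 := congr1 \val (e (oneI R)).
  have /= := I01P (cone u (zeroI R)); have /= := I01P (cone v (zeroI R)).
  have /= := I01P (cone u (oneI R)); have /= := I01P (cone v (oneI R)).
  have : \val (cone u (zeroI R)) < \val (cone u (oneI R)) by rewrite cone_lt /= ltr01.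
  have : \val (cone v (zeroI R)) < \val (cone v (oneI R)) by rewrite cone_lt /= ltr01.
  by case: b c e0 e1 {e} => -[] //=; lra.
by subst c; congr (_ :: _); apply: IH => x; apply: halve_inj (e x).
Qed.

End Cones.

Section Maps.
Variable R : realType.
Implicit Types (x y : I01 R) (b : bool) (u v w : seq bool) (f g h : thompsonF R).

Definition maps f u v := forall x, f (cone u x) = cone v x.

Lemma maps_cat f u v w : maps f u v -> maps f (u ++ w) (v ++ w).
Proof. by move=> m x; rewrite !cone_cat m. Qed.

Lemma maps_mul f g u v w : maps g u v -> maps f v w -> maps (f * g)%g u w.
Proof. by move=> m1 m2 x; rewrite thompsonF_mulE /= m1 m2. Qed.

Lemma maps_id u : maps 1%g u u.
Proof. by []. Qed.

Lemma maps_inv f u v : maps f u v -> maps f^-1%g v u.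
Proof. by move=> m x; rewrite -m; exact: thompsonF_funK. Qed.

Lemma thompsonF_increasing f : increasing f.
Proof. by have [] := thompsonFP f. Qed.

Lemma thompsonF0 f : f (zeroI R) = zeroI R.
Proof. exact: increasing0 (thompsonF_increasing f) (@thompsonF_invK _ f). Qed.

Lemma thompsonF1 f : f (oneI R) = oneI R.
Proof. exact: increasing1 (thompsonF_increasing f) (@thompsonF_invK _ f). Qed.

Lemma maps_unique f u v w : maps f u v -> maps f u w -> v = w.
Proof. by move=> m1 m2; apply: (@cone_determines R) => x; rewrite -m1 m2. Qed.

Lemma maps_nil f u : maps f u [::] -> u = [::].
Proof.
move=> /maps_inv m; apply: (@cone_onto R).
  by rewrite -m; exact: thompsonF0.
by rewrite -m; exact: thompsonF1.
Qed.

Lemma maps_ones f n v : maps f (nseq n true) v -> v = nseq (size v) true.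
Proof.
move=> m; apply: (@cone1_eq1 R); rewrite -m.
have -> : cone (nseq n true) (oneI R) = oneI R.
  by elim: n {m} => //= n ->; exact: halve11.
exact: thompsonF1.
Qed.

Lemma maps_zeros f n v : maps f (nseq n false) v -> v = nseq (size v) false.
Proof.
move=> m; apply: (@cone0_eq0 R); rewrite -m.
have -> : cone (nseq n false) (zeroI R) = zeroI R.
  by elim: n {m} => //= n ->; exact: halve00.
exact: thompsonF0.
Qed.

End Maps.

(** * Building elements of F *)

Section Construction.
Variable R : realType.
Implicit Types (x y : I01 R) (b : bool) (u v w : seq bool).

Lemma val_continuous : continuous (fun x : I01 R => \val x).
Proof. exact: initial_continuous. Qed.

(** Rays have open preimages: the endpoint of a ray is the image of a point, so
    monotonicity turns the preimage into a ray again. *)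
Lemma increasing_bijection_continuous (f g : I01 R -> I01 R) :
  increasing f -> cancel f g -> cancel g f -> continuous f.
Proof.
move=> fI fK gK.
suff cont (x : I01 R) : (fun y => \val (f y)) @ x --> \val (f x).
  by apply: continuous_comp_initial => x; exact: cont.
have P z : 0 <= \val (z : I01 R) <= 1 := I01P z.
have above (c : R) : c < \val (f x) -> \forall y \near x, c < \val (f y).
  move=> cf; have [c0|c0] := ltP c 0.
    by apply: (@nearW _ (nbhs x)) => y; apply: lt_le_trans c0 _; case/andP: (P (f y)).
  have c01 : c \in I01 R.
    by rewrite inE /I01 /= c0; case/andP: (P (f x)) => _ /(le_trans (ltW cf)).
  pose z : I01 R := exist (fun z : R => z \in I01 R) c c01.
  have gx : \val (g z) < \val x by rewrite -(increasing_lt _ _ fI) gK.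
  have : \forall y \near x, \val (g z) < \val y.
    exact: (cvgr_gt _ (@val_continuous x)).
  apply: (@filterS _ (nbhs x)) => y.
  by rewrite -(increasing_lt _ _ fI) gK.
have below (c : R) : \val (f x) < c -> \forall y \near x, \val (f y) < c.
  move=> cf; have [c0|c0] := ltP 1 c.
    by apply: (@nearW _ (nbhs x)) => y; apply: le_lt_trans c0; case/andP: (P (f y)).
  have c01 : c \in I01 R.
    by rewrite inE /I01 /= c0 andbT; case/andP: (P (f x)) => /le_trans/(_ (ltW cf)).
  pose z : I01 R := exist (fun z : R => z \in I01 R) c c01.
  have xg : \val x < \val (g z) by rewrite -(increasing_lt _ _ fI) gK.
  have : \forall y \near x, \val y < \val (g z).
    exact: (cvgr_lt _ (@val_continuous x)).
  apply: (@filterS _ (nbhs x)) => y.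
  by rewrite -(increasing_lt _ _ fI) gK.
apply: (iffRL (@cvgrPdist_lt _ _ _ (nbhs x) _ _ _)) => e e0.
have fa : \val (f x) - e < \val (f x) by rewrite /=; lra.
have fb : \val (f x) < \val (f x) + e by rewrite /=; lra.
apply: (@filterS2 _ (nbhs x) _ _ _ _ _ (above _ fa) (below _ fb)) => y ya yb.
by rewrite /= ltr_distlC ya yb.
Qed.

Lemma in_thompsonF_bijection (f g : I01 R -> I01 R) :
  increasing f -> cancel f g -> cancel g f -> dyadic_piecewise_linear f ->
  in_thompsonF f.
Proof.
move=> fI fK gK fP; split=> //; split; first exact: increasing_bijection_continuous gK.
exists g; split=> //; apply: increasing_bijection_continuous fK => //.
exact: increasing_can gK.
Qed.

Lemma halve_dyadic_fraction b x : dyadic_fractions x -> dyadic_fractions (halve b x).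
Proof.
move=> [[m [n xE]] x01]; split.
  exists ((b : nat)%:Z * 2 ^+ n + m), n.+1.
  rewrite /= xE rmorphD rmorphM rmorphXn /= exprS invfM.
  rewrite !mulrDl; congr (_ + _); last by rewrite mulrCA mulrA mulrC mulrA.
  by rewrite -mulrA [2 ^+ n * _]mulrCA divff ?expf_neq0 // mulr1.
by move: x01 => /=; case: b => /=; lra.
Qed.

Lemma lt_halve b x y : (\val (halve b x) < \val (halve b y)) = (\val x < \val y).
Proof. exact: (@cone_lt R [:: b]). Qed.

Lemma le_halve b x y : (\val (halve b x) <= \val (halve b y)) = (\val x <= \val y).
Proof. by rewrite !leNgt lt_halve. Qed.

Lemma halve_middle x : \val (halve false x) <= 1/2 <= \val (halve true x).
Proof. by have /= := I01P x; lra. Qed.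

Lemma halve_of b x :
  (if b then 1/2 <= \val x else \val x <= 1/2) -> exists y, x = halve b y.
Proof.
have [c [y ->]] := halve_surj x; have [-> _|] := eqVneq b c; first by exists y.
have /= yP := I01P y; case: b c => -[] //= _ h.
  by exists (zeroI R); rewrite -halve01; congr halve; apply: val_inj => /=; lra.
by exists (oneI R); rewrite halve01; congr halve; apply: val_inj => /=; lra.
Qed.

(** Two elements of F acting on the two halves of [0,1] agree at 1/2, because
    elements of F fix 0 and 1. *)
Lemma glue_subproof (f0 f1 : thompsonF R) :
  {h : thompsonF R | forall b x, h (halve b x) = halve b ((if b then f1 else f0) x)}.
Proof.
apply: cid.
pose F b : thompsonF R := if b then f1 else f0.
have glueE (G : bool -> thompsonF R) : exists h : I01 R -> I01 R,
    forall b x, h (halve b x) = halve b (G b x).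
  suff : forall x, exists y, forall b z, x = halve b z -> y = halve b (G b z).
    by move=> /choice[h hP]; exists h => b z; exact: hP.
  move=> x; have [b [z ->]] := halve_surj x; exists (halve b (G b z)) => c y e.
  have e' := congr1 \val e.
  case: b c e e' => -[] e e'; try by rewrite (halve_inj e).
    have /= zP := I01P z; have /= yP := I01P y; rewrite /= in e'.
    have -> : z = zeroI R by apply: val_inj => /=; lra.
    have -> : y = oneI R by apply: val_inj => /=; lra.
    by rewrite thompsonF0 thompsonF1 halve01.
  have /= zP := I01P z; have /= yP := I01P y; rewrite /= in e'.
  have -> : z = oneI R by apply: val_inj => /=; lra.
  have -> : y = zeroI R by apply: val_inj => /=; lra.
  by rewrite thompsonF0 thompsonF1 halve01.
have [h hE] := glueE F; have [h' h'E] := glueE (fun b => (F b)^-1%g).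
have hF : in_thompsonF h.
  apply: (@in_thompsonF_bijection h h').
  - move=> x y; have [b [z ->]] := halve_surj x; have [c [t ->]] := halve_surj y.
    rewrite !hE; case: b c => -[] e.
    + by rewrite lt_halve; apply: thompsonF_increasing; rewrite lt_halve in e.
    + by have := halve_middle z; have := halve_middle t; move: e; rewrite /=; lra.
    + have /= := halve_middle (F false z); have /= := halve_middle (F true t).
      move=> /andP[_ ft] /andP[fz _]; rewrite lt_neqAle (le_trans fz ft) andbT.
      apply/negP => /eqP e'.
      have /= zP := I01P z; have /= tP := I01P t.
      have F0 : F true t = zeroI R.
        by apply: val_inj => /=; have := I01P (F true t); have := I01P (F false z); rewrite /=; lra.
      have F1 : F false z = oneI R.
        by apply: val_inj => /=; have := I01P (F true t); have := I01P (F false z); rewrite /=; lra.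
      have t0 : t = zeroI R.
        by apply: (can_inj (thompsonF_funK (F true))); rewrite F0 thompsonF0.
      have z1 : z = oneI R.
        by apply: (can_inj (thompsonF_funK (F false))); rewrite F1 thompsonF1.
      by rewrite t0 z1 halve01 ltxx in e.
    + by rewrite lt_halve; apply: thompsonF_increasing; rewrite lt_halve in e.
  - move=> x; have [b [z ->]] := halve_surj x.
    by rewrite hE h'E; congr halve; exact: thompsonF_funK.
  - move=> x; have [b [z ->]] := halve_surj x.
    by rewrite h'E hE; congr halve; exact: thompsonF_invK.
  have [_ _ [s0 D0 P0]] := thompsonFP (F false).
  have [_ _ [s1 D1 P1]] := thompsonFP (F true).
  exists (halve false (oneI R) :: map (halve false) s0 ++ map (halve true) s1).
    move=> x /=; rewrite inE mem_cat => /or3P[/eqP ->|/mapP[t ts ->]|/mapP[t ts ->]].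
    + by split; [exists 1, 1%N; rewrite /= add0r | rewrite /=; lra].
    + exact/halve_dyadic_fraction/D0.
    + exact/halve_dyadic_fraction/D1.
  move=> x y xy noBreak.
  have [b bx] : exists b : bool, if b then 1/2 <= \val x else \val y <= 1/2.
    have [y2|y2] := leP (\val y) (1/2); first by exists false.
    exists true; rewrite leNgt; apply/negP => x2.
    by apply: (noBreak _ (mem_head _ _)); rewrite /= add0r x2 y2.
  have inHalf r : \val x <= \val r <= \val y -> exists r', r = halve b r'.
    move=> /andP[xr ry]; apply: halve_of; case: b bx => bx.
      exact: le_trans bx xr.
    exact: le_trans ry bx.
  have [|z xE] := inHalf x; first by rewrite lexx ltW.
  have [|t yE] := inHalf y; first by rewrite lexx ltW.
  have zt : \val z < \val t by move: xy; rewrite xE yE lt_halve.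
  have [k [c lin]] : exists (k : int) (c : R), forall r,
      \val z <= \val r <= \val t -> \val (F b r) = 2 ^ k * \val r + c.
    clear inHalf; case: b bx xE yE => bx xE yE.
      apply: P1 => // r rs /andP[zr rt]; apply: (noBreak (halve true r)).
        by rewrite inE mem_cat map_f // !orbT.
      by rewrite xE yE !lt_halve zr.
    apply: P0 => // r rs /andP[zr rt]; apply: (noBreak (halve false r)).
      by rewrite inE mem_cat map_f // !orbT.
    by rewrite xE yE !lt_halve zr.
  exists k, ((b%:R + c - 2 ^ k * b%:R) / 2) => r xry.
  have [r' rE] := inHalf r xry.
  have := lin r'; rewrite -(le_halve b z) -(le_halve b _ t) -xE -yE -rE => /(_ xry).
  rewrite rE hE /= => ->.
  by move: (2 ^ k) (b%:R : R) (sval r') => p q s; clear; lra.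
by exists (ThompsonF hF).
Qed.

End Construction.

Section Embedding.
Variable R : realType.
Implicit Types (x y : I01 R) (b : bool) (u v w : seq bool) (f g h : thompsonF R).

(** The standard generator of F: it rebrackets x(yz) into (xy)z. *)
Lemma rotation_subproof :
  {h : thompsonF R | [/\ maps h [:: false] [:: false; false],
     maps h [:: true; false] [:: false; true] & maps h [:: true; true] [:: true]]}.
Proof.
apply: cid.
have lift (phi : R -> R) : (forall r, 0 <= r <= 1 -> 0 <= phi r <= 1) ->
    exists h : I01 R -> I01 R, forall x, \val (h x) = phi (\val x).
  move=> phiP; have phi01 x : phi (\val x) \in I01 R by rewrite inE /I01 /= phiP // I01P.
  by exists (fun x => exist (fun z : R => z \in I01 R) _ (phi01 x)).
pose phi (r : R) := if r <= 1/2 then r / 2 else if r <= 3/4 then r - 1/4 else 2 * r - 1.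
pose psi (r : R) := if r <= 1/4 then 2 * r else if r <= 1/2 then r + 1/4 else (r + 1) / 2.
have phi_lt r t : r < t -> phi r < phi t.
  by clear; rewrite /phi => rt; case: (leP r (1/2)) => r2;
    [|case: (leP r (3/4)) => r3]; (case: (leP t (1/2)) => t2;
    [|case: (leP t (3/4)) => t3]); lra.
have phiK : cancel phi psi.
  clear; move=> r; rewrite /phi /psi; case: (leP r (1/2)) => r2.
    by case: leP => [|? ]; [|case: leP => ?]; lra.
  by case: (leP r (3/4)) => r3; (case: leP => ?; [|case: leP => ?]); lra.
have psiK : cancel psi phi.
  clear; move=> r; rewrite /phi /psi; case: (leP r (1/4)) => r4.
    by case: leP => [|? ]; [|case: leP => ?]; lra.
  by case: (leP r (1/2)) => r2; (case: leP => ?; [|case: leP => ?]); lra.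
have [|h hE] := lift phi.
  by clear; move=> r r01; rewrite /phi; case: (leP r (1/2)) => ?; [|case: (leP r (3/4)) => ?]; lra.
have [|h' h'E] := lift psi.
  by clear; move=> r r01; rewrite /psi; case: (leP r (1/4)) => ?; [|case: (leP r (1/2)) => ?]; lra.
have hF : in_thompsonF h.
  apply: (@in_thompsonF_bijection _ h h').
  - by move=> x y; rewrite !hE; exact: phi_lt.
  - by move=> x; apply: val_inj; rewrite h'E hE phiK.
  - by move=> x; apply: val_inj; rewrite hE h'E psiK.
  exists [:: cone [:: false] (oneI R); cone [:: true; false] (oneI R)].
    move=> x /=; rewrite !inE => /orP[/eqP ->|/eqP ->].
      by split; [exists 1, 1%N; rewrite /= add0r | rewrite /=; lra].
    split; last by rewrite /=; lra.
    by exists 3, 2%N; rewrite /= expr2; lra.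
  move=> x y xy noBreak.
  have [y2|y2] := leP (\val y) (1/2).
    exists (-1), 0 => r /andP[_ ry]; rewrite hE /phi (le_trans ry y2).
    by rewrite exprN1 addr0 mulrC.
  have x2 : 1/2 <= \val x.
    rewrite leNgt; apply/negP => x2.
    by apply: (noBreak _ (mem_head _ _)); move: x2 y2 => /= x2 y2; lra.
  have [y3|y3] := leP (\val y) (3/4).
    exists 0, (-1/4) => r /andP[xr ry]; rewrite hE /phi expr0z.
    by case: (leP (\val r) (1/2)); case: (leP (\val r) (3/4)); lra.
  have x3 : 3/4 <= \val x.
    rewrite leNgt; apply/negP => x3.
    apply: (noBreak (cone [:: true; false] (oneI R))); first by rewrite !inE eqxx orbT.
    by move: x3 y3 => /= x3 y3; lra.
  exists 1, (-1) => r /andP[xr ry]; rewrite hE /phi expr1z.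
  by case: (leP (\val r) (1/2)); case: (leP (\val r) (3/4)); lra.
exists (ThompsonF hF); split=> x; apply: val_inj; have /= xP := I01P x; rewrite hE /phi /=.
- by case: leP => ?; [|case: leP => ?]; lra.
- by case: leP => ?; [|case: leP => ?]; lra.
- by case: leP => ?; [|case: leP => ?]; lra.
Qed.

Definition rotation : thompsonF R := sval rotation_subproof.

Lemma maps_rotation0 : maps rotation [:: false] [:: false; false].
Proof. by rewrite /rotation; case: rotation_subproof => h []. Qed.

Lemma maps_rotation10 : maps rotation [:: true; false] [:: false; true].
Proof. by rewrite /rotation; case: rotation_subproof => h []. Qed.

Lemma maps_rotation11 : maps rotation [:: true; true] [:: true].
Proof. by rewrite /rotation; case: rotation_subproof => h []. Qed.

Definition glue f0 f1 : thompsonF R := sval (glue_subproof f0 f1).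

Lemma glueE f0 f1 b x : glue f0 f1 (halve b x) = halve b ((if b then f1 else f0) x).
Proof. by rewrite /glue; case: glue_subproof. Qed.

(** The copy of [g] acting inside the interval of [u]. *)
Fixpoint emb u g : thompsonF R :=
  if u is b :: u then
    glue (if b then 1%g else emb u g) (if b then emb u g else 1%g)
  else g.

Lemma emb_cat u v g : emb (u ++ v) g = emb u (emb v g).
Proof. by elim: u => //= b u ->. Qed.

Lemma emb_cone u g x : emb u g (cone u x) = cone u (g x).
Proof. by elim: u => //= b u IH; rewrite glueE; case: b; rewrite IH. Qed.

Lemma emb_out u g x : (forall y, x <> cone u y) -> emb u g x = x.
Proof.
elim: u x => [|b u IH] x xu /=; first by case: (xu x).
have [c [z xE]] := halve_surj x; rewrite xE glueE.
have IHz : c = b -> emb u g z = z.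
  by move=> cb; apply: IH => y zE; apply: (xu y); rewrite xE zE cb.
by case: b c {xu xE} IHz => -[] //= ->.
Qed.

Lemma maps_emb u g v w : maps g v w -> maps (emb u g) (u ++ v) (u ++ w).
Proof. by move=> m x; rewrite !cone_cat emb_cone m. Qed.

Fixpoint diverge u v : bool :=
  match u, v with b :: u, c :: v => (b != c) || diverge u v | _, _ => false end.

Lemma maps_emb_diverge u v g : diverge u v -> maps (emb u g) v v.
Proof.
elim: u v => [|b u IH] [|c v] //= d x; rewrite glueE.
by case: b c d => -[] //= d; rewrite IH.
Qed.

(** An element acting affinely on an interval transports what happens inside
    it. Commutation is the case [u = v]. *)
Lemma conj_emb h u v g : maps h u v -> (h * emb u g = emb v g * h)%g.
Proof.
move=> m; apply: thompsonF_eq => x; rewrite !thompsonF_mulE /=.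
have [[y ->]|xu] := pselect (exists y, x = cone u y).
  by rewrite emb_cone !m emb_cone.
rewrite !emb_out // => [y hx|y xE]; last by apply: xu; exists y.
by apply: xu; exists y; apply: (can_inj (thompsonF_funK h)); rewrite hx m.
Qed.

Lemma embM u g h : emb u (g * h)%g = (emb u g * emb u h)%g.
Proof.
apply: thompsonF_eq => x; rewrite thompsonF_mulE /=.
have [[y ->]|xu] := pselect (exists y, x = cone u y).
  by rewrite !emb_cone.
by rewrite !emb_out // => y xE; apply: xu; exists y.
Qed.

Lemma emb1 u : emb u 1%g = 1%g.
Proof. by apply: (mulgI (emb u 1%g)); rewrite -embM !mulg1. Qed.

Lemma embV u g : emb u g^-1%g = (emb u g)^-1%g.
Proof. by apply: (mulgI (emb u g)); rewrite -embM !mulgV emb1. Qed.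

End Embedding.

Arguments emb : simpl never.

(** * Dyadic subdivisions adapted to an element of F *)

Section Subdivision.
Variable R : realType.
Implicit Types (x y : I01 R) (b : bool) (u v w : seq bool) (f g h : thompsonF R).

Lemma cone_affine u x :
  \val (cone u x) = \val (cone u (zeroI R)) + \val x / 2 ^+ size u.
Proof.
elim: u => [|b u IH] /=; first by rewrite add0r divr1.
by rewrite /= in IH; rewrite IH exprS invfM; move: (_ ^-1) => p; lra.
Qed.

Lemma cone_start u :
  exists i : nat, \val (cone u (zeroI R)) = i%:R / 2 ^+ size u.
Proof.
elim: u => [|b u [i IH]]; first by exists 0%N; rewrite mul0r.
exists (b * 2 ^ size u + i)%N.
rewrite /= in IH *; rewrite IH natrD natrM natrX exprS.
by field; rewrite expf_neq0.
Qed.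

Lemma cone_of_start n i : (i < 2 ^ n)%N ->
  exists2 v, size v = n & \val (cone v (zeroI R)) = i%:R / 2 ^+ n.
Proof.
elim: n i => [|n IH] i.
  by rewrite expn0 ltnS leqn0 => /eqP ->; exists [::]; rewrite //= mul0r.
rewrite expnS mul2n -addnn => ilt.
have [ib|ib] := ltnP i (2 ^ n).
  have [v sv vE] := IH i ib; exists (false :: v); rewrite /= ?sv //.
  rewrite /= in vE; rewrite vE exprS.
  by field; rewrite expf_neq0.
have [|v sv vE] := IH (i - 2 ^ n)%N; first by rewrite ltn_subLR.
exists (true :: v); rewrite /= ?sv //.
rewrite /= in vE; rewrite vE exprS natrB // natrX.
by field; rewrite expf_neq0.
Qed.

Lemma is_dyadic_level (r : R) : is_dyadic r ->
  exists e, forall n, (e <= n)%N -> exists m : int, r = m%:~R / 2 ^+ n.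
Proof.
move=> [m [e ->]]; exists e => n en; exists (m * 2 ^+ (n - e)).
rewrite -{2}(subnKC en) exprD rmorphM rmorphXn /=.
by field; rewrite !expf_neq0.
Qed.

Lemma common_level (s : seq (I01 R)) : [set` s] `<=` @dyadic_fractions R ->
  exists n, forall t, t \in s -> exists m : int, \val t = m%:~R / 2 ^+ n.
Proof.
move=> sD; suff [e eP] : exists e, forall n, (e <= n)%N ->
    forall t, t \in s -> exists m : int, \val t = m%:~R / 2 ^+ n.
  by exists e => t; exact: eP.
elim: s sD => [|x s IH] sD; first by exists 0%N.
have [|e1 e1P] := IH; first by move=> t ts; apply: sD; rewrite /= inE; apply/orP; right.
have [xD _] := sD x (mem_head _ _); have [e2 e2P] := is_dyadic_level xD.
exists (maxn e1 e2) => n; rewrite geq_max => /andP[n1 n2] t.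
by rewrite inE => /orP[/eqP ->|]; [exact: e2P|exact: e1P].
Qed.

(** If [f] has slope 2^k on the interval of [u], a subinterval of length
    2^-(n+j) goes to one of length 2^-M with M = n + j - k, and for large j the
    denominators of the endpoints divide 2^M, so the image is a dyadic interval
    of a word. *)
Lemma affine_subdivision f u (k : int) (c : R) :
  (forall x, \val (f (cone u x)) = 2 ^ k * \val (cone u x) + c) ->
  exists j, forall w, (j <= size w)%N -> exists v, maps f (u ++ w) v.
Proof.
move=> lin; set n := size u.
have pD : is_dyadic (\val (f (cone u (zeroI R)))).
  apply/(thompsonF_dyadic _ (thompsonFP f)).
  by have [i iE] := cone_start u; exists i, n; rewrite iE.
have [e eP] := is_dyadic_level pD.
exists (e + `|k - n%:Z|)%N => w jw; set j := size w in jw.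
have [M ME] : exists M : nat, M%:Z = (j + n)%:Z - k.
  by exists `|(j + n)%:Z - k|%N; rewrite gez0_abs //; lia.
have eM : (e <= M)%N by lia.
have [m mE] := eP M eM; have [i iE] := cone_start w.
have two0 : (2 : R) != 0 by rewrite pnatr_eq0.
have slope : (2 : R) ^ k / 2 ^+ (j + n) = (2 ^+ M)^-1.
  have e1 : (2 : R) ^ k * 2 ^+ M = 2 ^+ (j + n).
    by rewrite !exprnP -expfzDr // ME; congr (_ ^ _); lia.
  by rewrite -e1 invfM mulrA divff ?expfz_neq0 // mul1r.
have fE x : \val (f (cone (u ++ w) x)) = (m + i%:Z)%:~R / 2 ^+ M + \val x / 2 ^+ M.
  rewrite cone_cat; have := lin (zeroI R); rewrite mE lin => e0.
  rewrite cone_affine [\val (cone w x)]cone_affine iE -/j -/n.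
  have -> : c = m%:~R / 2 ^+ M - 2 ^ k * \val (cone u (zeroI R)) by rewrite e0; ring.
  rewrite rmorphD /= -slope exprD.
  by field; rewrite !expf_neq0.
have M0 : 0 < (2 : R) ^+ M by rewrite exprn_gt0.
have t0 : 0 <= m + i%:Z.
  have := I01P (f (cone (u ++ w) (zeroI R))); rewrite fE mul0r addr0 => /andP[+ _].
  by rewrite pmulr_lge0 ?invr_gt0 // ler0z.
have t1 : m + i%:Z + 1 <= 2 ^+ M.
  have := I01P (f (cone (u ++ w) (oneI R))); rewrite fE -mulrDl => /andP[_].
  rewrite ler_pdivrMr // mul1r.
  by rewrite -[X in _ + X](_ : 1%:~R = 1) // -rmorphD -[2]/(2%:~R) -rmorphXn ler_int.
have [T TE] : exists T : nat, m + i%:Z = T%:Z.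
  by exists (absz (m + i%:Z)); rewrite gez0_abs.
rewrite TE in fE t1.
have [|v sv vE] := @cone_of_start M T.
  by rewrite -(ler_nat int) -addn1 natrD natrX natz.
by exists v => x; apply: val_inj; rewrite fE cone_affine vE sv.
Qed.

(** Finitely many words of a fixed length suffice to cover [0,1], so the local
    depths given by the previous lemma have a common bound. *)
Lemma thompsonF_subdivision f : exists n, forall u, (n <= size u)%N -> exists v, maps f u v.
Proof.
have [_ _ [s sD sP]] := thompsonFP f.
have [n nP] := common_level sD.
have affine u : size u = n -> exists (k : int) (c : R), forall x,
    \val (f (cone u x)) = 2 ^ k * \val (cone u x) + c.
  move=> su; have [||k [c kc]] := sP (cone u (zeroI R)) (cone u (oneI R)).
  - by rewrite cone_lt /= ltr01.
  - move=> t ts; rewrite [\val (cone u (oneI R))]cone_affine su.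
    have [i ->] := cone_start u; have [m ->] := nP t ts.
    rewrite su -mulrDl !ltr_pM2r ?invr_gt0 ?exprn_gt0 //.
    by rewrite -[X in _ + X](_ : 1%:~R = 1) // -[i%:R]/(i%:Z%:~R) -rmorphD !ltr_int; lia.
  exists k, c => x; apply: kc.
  by rewrite !leNgt !cone_lt -!leNgt I01P.
have local u : size u = n -> exists j, forall w, (j <= size w)%N ->
    exists v, maps f (u ++ w) v.
  by move=> /affine [k [c]]; exact: affine_subdivision.
have [J JP] := choice (fun t : n.-tuple bool => local t (size_tuple t)).
exists (n + \max_(t : n.-tuple bool) J t)%N => u nju.
have su : size (take n u) == n by rewrite size_takel //; lia.
rewrite -(cat_take_drop n u); apply: (JP (Tuple su)); rewrite size_drop.
apply: leq_trans (@leq_bigmax _ J (Tuple su)) _.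
by rewrite leq_subRL // (leq_trans _ nju) // leq_addr.
Qed.

End Subdivision.

(** * Binary trees and their reduction to right combs *)

Inductive tree := Leaf | Node of tree & tree.

Fixpoint leaves (T : tree) : seq (seq bool) :=
  if T is Node A B then map (cons false) (leaves A) ++ map (cons true) (leaves B)
  else [:: [::]].

Fixpoint weight (T : tree) : nat :=
  if T is Node A B then (weight A + weight B)%N else 1%N.

(** The number of leaves other than the last one. *)
Fixpoint spine_weight (T : tree) : nat :=
  if T is Node A B then (weight A + spine_weight B)%N else 0%N.

Section Trees.
Variable R : realType.
Implicit Types (x y z : I01 R) (b : bool) (u v w : seq bool) (f g h : thompsonF R).
Implicit Types (l : seq (seq bool)) (T A B : tree).

Fixpoint chain x l y : Prop :=
  if l is v :: l then cone v (zeroI R) = x /\ chain (cone v (oneI R)) l y else x = y.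

Lemma chain_cat x l1 l2 y z : chain x l1 y -> chain y l2 z -> chain x (l1 ++ l2) z.
Proof. by elim: l1 x => [|v l IH] x /=; [move-> | case=> -> c /(IH _ c)]. Qed.

Lemma chain_cons b x l y :
  chain x l y -> chain (halve b x) (map (cons b) l) (halve b y).
Proof. by elim: l x => [|v l IH] x /=; [move-> | case=> <- /IH]. Qed.

Lemma leaves_chain T : chain (zeroI R) (leaves T) (oneI R).
Proof.
elim: T => [|A IHA B IHB] //=.
rewrite -{1}halve00 -{1}halve11; apply: chain_cat (chain_cons true IHB).
by rewrite -halve01; exact: chain_cons IHA.
Qed.

Lemma cone_start_lt1 u : \val (cone u (zeroI R)) < 1.
Proof.
have : \val (cone u (zeroI R)) < \val (cone u (oneI R)) by rewrite cone_lt /= ltr01.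
by move/lt_le_trans; apply; case/andP: (I01P (cone u (oneI R))).
Qed.

Lemma cone_end_gt0 u : 0 < \val (cone u (oneI R)).
Proof.
have : \val (cone u (zeroI R)) < \val (cone u (oneI R)) by rewrite cone_lt /= ltr01.
by apply: le_lt_trans; case/andP: (I01P (cone u (zeroI R))).
Qed.

Lemma chain_right x l : [::] \notin l -> chain (halve true x) l (oneI R) ->
  exists2 l1, l = map (cons true) l1 & chain x l1 (oneI R).
Proof.
elim: l x => [|v l IH] x /=.
  move=> _ e; exists [::] => //=; apply: val_inj.
  by move: (congr1 \val e) => /=; lra.
rewrite inE negb_or => /andP[v0 l0] [vE c].
case: v v0 vE c => [//|[] v] _ /= vE c; last first.
  have := cone_start_lt1 v; have := I01P x.
  by move: (congr1 \val vE) => /= *; (suff : (1 : R) < 0 by rewrite ltr10); lra.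
have [l1 -> c1] := IH _ l0 c; exists (v :: l1) => //=.
by rewrite (halve_inj vE).
Qed.

Lemma chain_split x l : [::] \notin l -> chain (halve false x) l (oneI R) ->
  exists l0 l1, [/\ l = map (cons false) l0 ++ map (cons true) l1,
    chain x l0 (oneI R) & chain (zeroI R) l1 (oneI R)].
Proof.
elim: l x => [|v l IH] x /=.
  move=> _ e; have := I01P x; move: (congr1 \val e) => /= *.
  by (suff : (1 : R) < 0 by rewrite ltr10); lra.
rewrite inE negb_or => /andP[v0 l0] [vE c].
case: v v0 vE c => [//|[] v] _ /= vE c; last first.
  have [l1 [l2 [-> c1 c2]]] := IH _ l0 c; exists (v :: l1), l2; split=> //=.
  by rewrite (halve_inj vE).
have := I01P (cone v (zeroI R)); have := I01P x; move: (congr1 \val vE) => /= e xP vP.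
have v00 : cone v (zeroI R) = zeroI R by apply: val_inj => /=; clear IH; lra.
have x1 : x = oneI R by apply: val_inj => /=; clear IH; lra.
have [l1 -> c1] := chain_right l0 c.
by exists [::], (v :: l1); rewrite /= v00 x1.
Qed.

(** Consecutive dyadic intervals filling [0,1] are the leaves of a tree: unless
    [0,1] is one of them, none crosses 1/2, so the list splits at 1/2 and both
    parts are rescaled. *)
Lemma chain_leaves l : chain (zeroI R) l (oneI R) -> exists T, leaves T = l.
Proof.
have [n ln] : exists n, all (fun v => (size v <= n)%N) l.
  elim: l => [|v l [n ln]]; first by exists 0%N.
  exists (maxn (size v) n) => /=; rewrite leq_maxl /=.
  by apply: sub_all ln => u /leq_trans; apply; exact: leq_maxr.
elim: n l ln => [|n IH] l ln c.
  case: l ln c => [_ /(congr1 \val)/= e|[|//] l /= ln [_ c]].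
    by (suff : (1 : R) < 0 by rewrite ltr10); lra.
  case: l ln c => [_ _|v l ln [/(congr1 \val) /= e _]]; first by exists Leaf.
  by have := cone_start_lt1 v; rewrite /= e ltxx.
have [l0|l0] := boolP ([::] \in l).
  exists Leaf; case: l l0 ln c => [//|[|b v] l] l0 ln /= [e c].
    case: l c {l0 ln e} => [//|v l [/(congr1 \val) /= e _]].
    by have := cone_start_lt1 v; rewrite /= e ltxx.
  move: l0; rewrite inE /= => l0; exfalso.
  move: (cone_end_gt0 (b :: v)); move: c l0; rewrite -[halve _ _]/(cone (b :: v) _).
  move: (cone _ _) => y; clear.
  (* the interval of the empty word starts at 0, to the left of all later ones *)
  elim: l y => [//|v l IH] y /= [e c]; rewrite inE => /orP[/eqP v0|/IH l0].
    by rewrite -e -v0 /= ltxx.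
  by move=> _; apply: l0 c _; exact: cone_end_gt0.
rewrite -halve00 in c; have [l1 [l2 [lE c1 c2]]] := chain_split l0 c.
move: ln; rewrite lE all_cat !all_map => /andP[/IH/(_ c1)[A <-] /IH/(_ c2)[B <-]].
by exists (Node A B).
Qed.

Fixpoint maps_all f l l' : Prop :=
  match l, l' with
  | u :: l, v :: l' => maps f u v /\ maps_all f l l'
  | [::], [::] => True
  | _, _ => False
  end.

Lemma maps_all_size f l l' : maps_all f l l' -> size l = size l'.
Proof. by elim: l l' => [|u l IH] [|v l'] //= [_ /IH ->]. Qed.

Lemma maps_all_cat f l1 l1' l2 l2' :
  maps_all f l1 l1' -> maps_all f l2 l2' -> maps_all f (l1 ++ l2) (l1' ++ l2').
Proof. by elim: l1 l1' => [|u l IH] [|v l'] //= [m c] /(IH _ c). Qed.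

Lemma maps_all_mul f g l1 l2 l3 :
  maps_all g l1 l2 -> maps_all f l2 l3 -> maps_all (f * g)%g l1 l3.
Proof.
elim: l1 l2 l3 => [|u l1 IH] [|v l2] [|w l3] //= [m1 c1] [m2 c2].
by split; [exact: maps_mul m1 m2 | exact: IH c1 c2].
Qed.

Lemma maps_all_inv f l l' : maps_all f l l' -> maps_all f^-1%g l' l.
Proof.
elim: l l' => [|u l IH] [|v l'] //= [m c].
by split; [exact: maps_inv | exact: IH].
Qed.

Lemma maps_all_map f (T : Type) (a b : T -> seq bool) (s : seq T) :
  (forall t, maps f (a t) (b t)) -> maps_all f (map a s) (map b s).
Proof. by move=> m; elim: s => //= t s IH; split. Qed.

Lemma maps_all_ex f l : (forall u, u \in l -> exists v, maps f u v) ->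
  exists l', maps_all f l l'.
Proof.
elim: l => [|u l IH] lP; first by exists [::].
have [|l' c] := IH; first by move=> v vl; apply: lP; rewrite inE vl orbT.
by have [v m] := lP u (mem_head _ _); exists (v :: l').
Qed.

Lemma maps_all_chain f x l l' y :
  maps_all f l l' -> chain x l y -> chain (f x) l' (f y).
Proof.
elim: l l' x => [|u l IH] [|v l'] x //=; first by move=> _ ->.
by move=> [m c] [<- c']; rewrite -!m; split=> //; apply: IH c c'.
Qed.

Lemma leaf_cone T x : exists2 u, u \in leaves T & exists y, x = cone u y.
Proof.
elim: T x => [|A IHA B IHB] x; first by exists [::] => //; exists x.
have [[] [y ->]] := halve_surj x.
  have [u uB [z ->]] := IHB y; exists (true :: u); last by exists z.
  by rewrite /= mem_cat map_f ?orbT.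
have [u uA [z ->]] := IHA y; exists (false :: u); last by exists z.
by rewrite /= mem_cat map_f.
Qed.

Lemma eq_thompsonF_leaves T f g l :
  maps_all f (leaves T) l -> maps_all g (leaves T) l -> f = g.
Proof.
move=> fl gl; apply: thompsonF_eq => x; have [u uT [y ->]] := leaf_cone T x.
elim: (leaves T) l fl gl uT => [//|v l IH] [//|w l'] /= [m1 c1] [m2 c2].
by rewrite inE => /orP[/eqP ->|/(IH _ c1 c2)//]; rewrite m1 m2.
Qed.

Fixpoint full_tree n := if n is n.+1 then Node (full_tree n) (full_tree n) else Leaf.

Lemma full_tree_size n u : u \in leaves (full_tree n) -> size u = n.
Proof.
elim: n u => [|n IH] u; first by rewrite inE => /eqP ->.
by rewrite /= mem_cat => /orP[] /mapP[v /IH <- ->].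
Qed.

(** The image of a fine enough uniform partition is again a partition into
    dyadic intervals of words, hence comes from a tree. *)
Lemma tree_pair f : exists T S, maps_all f (leaves T) (leaves S).
Proof.
have [n nP] := thompsonF_subdivision f; exists (full_tree n).
have [l lP] : exists l, maps_all f (leaves (full_tree n)) l.
  by apply: maps_all_ex => u /full_tree_size un; apply: nP; rewrite un.
have := maps_all_chain lP (leaves_chain _); rewrite thompsonF0 thompsonF1.
by move=> /chain_leaves[S SE]; exists S; rewrite SE.
Qed.

Definition ones k := nseq k true.

(** The positions of a right comb: the interval [1 - 2^-k, 1 - 2^-(k+1)]. *)
Definition spine k := rcons (ones k) false.

Arguments ones : simpl never.
Arguments spine : simpl never.

Fixpoint comb k n := if n is n.+1 then spine k :: comb k.+1 n else [::].

Definition vine k n := rcons (comb k n) (ones (k + n)).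

Lemma ones_cat j k : ones j ++ ones k = ones (j + k).
Proof. by rewrite /ones nseqD. Qed.

Lemma ones_spine j k : ones j ++ spine k = spine (j + k).
Proof. by rewrite /spine -rcons_cat ones_cat. Qed.

Lemma comb_cat k m n : comb k (m + n) = comb k m ++ comb (k + m) n.
Proof. by elim: m k => [|m IH] k /=; rewrite ?addn0 // IH addSnnS. Qed.

Lemma map_ones_comb j k n : map (cat (ones j)) (comb k n) = comb (j + k) n.
Proof. by elim: n k => //= n IH k; rewrite ones_spine IH addnS. Qed.

(** Subdivides the interval at position [k] into those at positions [k] and
    [k.+1], pushing the later positions one step to the right. *)
Definition split_at k : thompsonF R := emb (ones k) (rotation R)^-1%g.

Lemma maps_split_left k : maps (split_at k) (rcons (spine k) false) (spine k).
Proof.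
rewrite /spine -!cats1 -catA; apply: maps_emb.
exact: maps_inv (@maps_rotation0 R).
Qed.

Lemma maps_split_right k : maps (split_at k) (rcons (spine k) true) (spine k.+1).
Proof.
rewrite -(addn1 k) -ones_spine /spine -!cats1 -catA; apply: maps_emb.
exact: maps_inv (@maps_rotation10 R).
Qed.

Lemma maps_split_tail k : maps (split_at k) (ones k.+1) (ones k.+2).
Proof.
rewrite -[k.+2]addn2 -[k.+1]addn1 -!ones_cat; apply: maps_emb.
exact: maps_inv (@maps_rotation11 R).
Qed.

Lemma diverge_spine j k w : (j < k)%N -> diverge (ones k) (spine j ++ w).
Proof. by elim: j k => [|j IH] [|k] //= jk; exact: IH. Qed.

Lemma maps_split_before j k : (j < k)%N -> maps (split_at k) (spine j) (spine j).
Proof. by move=> jk; apply: maps_emb_diverge; rewrite -[spine j]cats0 diverge_spine. Qed.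

(** Spreads the leaves of [A], placed at position [k], over consecutive
    positions. The right subtree is treated first, before the left one pushes it
    to its final place. *)
Fixpoint comb_map k A : thompsonF R :=
  if A is Node A B then (comb_map k A * (comb_map k.+1 B * split_at k))%g else 1%g.

(** Straightens the tree [T], placed on the interval [1 - 2^-k, 1], to a right
    comb. *)
Fixpoint vine_map k T : thompsonF R :=
  if T is Node A B then (vine_map (k + weight A) B * comb_map k A)%g else 1%g.

Lemma maps_comb_before j k A : (j < k)%N -> maps (comb_map k A) (spine j) (spine j).
Proof.
elim: A k => [|A IHA B IHB] k jk //=.
apply: maps_mul (maps_mul (maps_split_before jk) _) (IHA _ jk).
by apply: IHB; rewrite ltnS ltnW.
Qed.

Lemma maps_comb_tail k A : maps (comb_map k A) (ones k.+1) (ones (k + weight A)).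
Proof.
elim: A k => [|A IHA B IHB] k /=; first by rewrite addn1.
apply: maps_mul (maps_mul (maps_split_tail k) (IHB k.+1)) _.
by rewrite addnA -!(ones_cat _ (weight B)); apply: maps_cat (IHA k).
Qed.

Lemma maps_comb k A :
  maps_all (comb_map k A) (map (cat (spine k)) (leaves A)) (comb k (weight A)).
Proof.
elim: A k => [|A IHA B IHB] k /=; first by rewrite cats0.
rewrite map_cat comb_cat; apply: maps_all_cat.
  apply: maps_all_mul (IHA k); rewrite -!map_comp; apply: maps_all_map => w.
  rewrite -[X in maps _ X _]/(spine k ++ false :: w) -cat_rcons.
  apply: maps_cat; apply: maps_mul (maps_split_left k) _.
  exact: maps_comb_before.
apply: maps_all_mul (_ : maps_all _ _ (comb k.+1 (weight B))) _.
  apply: maps_all_mul (IHB k.+1); rewrite -!map_comp; apply: maps_all_map => w.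
  rewrite -[X in maps _ X _]/(spine k ++ true :: w) -cat_rcons.
  exact/maps_cat/maps_split_right.
have := maps_all_map (comb 0 (weight B)) (fun w => maps_cat w (maps_comb_tail k A)).
by rewrite !map_ones_comb !addn0.
Qed.

Lemma maps_vine_before j k T : (j < k)%N -> maps (vine_map k T) (spine j) (spine j).
Proof.
elim: T k => [|A _ B IH] k jk //=; apply: maps_mul (maps_comb_before A jk) _.
by apply: IH; rewrite ltn_addr.
Qed.

Lemma maps_all_comb_fix f k n :
  (forall j, (j < k + n)%N -> maps f (spine j) (spine j)) ->
  maps_all f (comb k n) (comb k n).
Proof.
elim: n k => [//|n IH] k fP /=; split; first by apply: fP; lia.
by apply: IH => j; rewrite addSnnS; exact: fP.
Qed.

Lemma maps_vine k T :
  maps_all (vine_map k T) (map (cat (ones k)) (leaves T)) (vine k (spine_weight T)).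
Proof.
elim: T k => [|A _ B IH] k /=; first by rewrite cats0 addn0.
rewrite map_cat /vine comb_cat addnA rcons_cat; apply: maps_all_cat.
  apply: (@maps_all_mul _ _ _ (comb k (weight A))).
    rewrite -map_comp; have := maps_comb k A; congr maps_all.
    by apply: eq_map => w; rewrite /spine cat_rcons.
  by apply: maps_all_comb_fix => j; exact: maps_vine_before.
apply: maps_all_mul (IH _); rewrite -map_comp; apply: maps_all_map => w.
rewrite -[X in maps _ X _]/(ones k ++ ones 1 ++ w) catA ones_cat addn1.
exact/maps_cat/maps_comb_tail.
Qed.

End Trees.

(** * The colouring and the group preserving it *)

(** [Sl] is the state of the intervals starting at 0. The other states are those
    of inner intervals. *)
Inductive state := Sl | Sa | Sb | Sc.

Definition child q b := match q, b with
  | Sl, false => Sl | Sl, true => Sa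
  | Sa, false => Sa | Sa, true => Sb
  | Sb, false => Sa | Sb, true => Sc
  | Sc, _ => Sb
  end.

Definition run q (u : seq bool) := foldl child q u.

(** The state of [u] when the interval at the first position has state [q];
    intervals ending at 1 have no state, and all later positions have state
    [Sa]. *)
Fixpoint spine_state q (u : seq bool) := match u with
  | [::] => None
  | false :: u => Some (run q u)
  | true :: u => spine_state Sa u
  end.

Definition state_of := spine_state Sl.

Fixpoint colors q T :=
  if T is Node A B then colors (child q false) A ++ colors (child q true) B
  else [:: q].

Fixpoint spine_colors q T :=
  if T is Node A B then colors q A ++ spine_colors Sa B else [::].

(** Thanks to this injectivity, states may be compared on small
    subintervals only. *)
Lemma child_inj q q' : (forall b, child q b = child q' b) -> q = q'.
Proof. by move=> e; move: (e false) (e true); case: q {e}; case: q'. Qed.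

Lemma spine_state_rcons q u b : spine_state q (rcons u b) =
  match spine_state q u with
  | Some p => Some (child p b)
  | None => if b then None else Some (if u is [::] then q else Sa)
  end.
Proof.
elim: u q => [|[] u IH] q /=; first by case: b.
  by rewrite IH; case: u {IH}.
by rewrite /run -cats1 foldl_cat.
Qed.

(** The empty word is excluded: its left half has state [q], the left half of
    any other interval ending at 1 has state [Sa]. *)
Lemma spine_state_cat q u w : u != [::] -> spine_state q (u ++ w) =
  if spine_state q u is Some p then Some (run p w) else spine_state Sa w.
Proof.
elim: u q => [//|[] u IH] q _ /=; last by rewrite /run foldl_cat.
by case: u IH => [//|b u] IH; rewrite IH.
Qed.

Lemma state_of_determined n u v :
  (forall w, size w = n -> state_of (u ++ w) = state_of (v ++ w)) ->
  state_of u = state_of v.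
Proof.
elim: n u v => [|n IH] u v e; first by have := e [::] erefl; rewrite !cats0.
have step b : state_of (rcons u b) = state_of (rcons v b).
  by apply: IH => w wn; rewrite !cat_rcons; apply: e; rewrite /= wn.
move: (step false) (step true); rewrite /state_of !spine_state_rcons.
case: spine_state => [p|]; case: spine_state => [p'|] //.
by move=> [e0] [e1]; congr Some; apply: child_inj => -[].
Qed.

Lemma leaves_run q T : map (run q) (leaves T) = colors q T.
Proof.
elim: T q => [|A IHA B IHB] q //=; rewrite map_cat -!map_comp.
by rewrite -IHA -IHB; congr cat; apply: eq_map => w.
Qed.

Lemma leaves_spine_state q T :
  map (spine_state q) (leaves T) = rcons (map Some (spine_colors q T)) None.
Proof.
elim: T q => [|A _ B IH] q //=; rewrite !map_cat -!map_comp rcons_cat.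
rewrite -leaves_run -map_comp -IH.
by congr cat; apply: eq_map => w.
Qed.

Lemma leaves_prefix T :
  exists n, forall u, (n <= size u)%N -> exists t w, t \in leaves T /\ u = t ++ w.
Proof.
elim: T => [|A [m mP] B [n nP]].
  by exists 0%N => u _; exists [::], u.
exists (maxn m n).+1 => -[//|[] u] /=; rewrite ltnS geq_max => /andP[um un].
  have [t [w [tB ->]]] := nP u un; exists (true :: t), w.
  by rewrite mem_cat map_f ?orbT.
have [t [w [tA ->]]] := mP u um; exists (false :: t), w.
by rewrite mem_cat map_f.
Qed.

Lemma size_colors q T : size (colors q T) = weight T.
Proof. by elim: T q => //= A IHA B IHB q; rewrite size_cat IHA IHB. Qed.

Lemma size_spine_colors q T : size (spine_colors q T) = spine_weight T.
Proof. by elim: T q => //= A _ B IH q; rewrite size_cat size_colors IH. Qed.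

Lemma size_leaves T : size (leaves T) = (spine_weight T).+1.
Proof.
rewrite -(size_map (spine_state Sl)) leaves_spine_state size_rcons size_map.
by rewrite size_spine_colors.
Qed.

Section TreePairs.
Variable R : realType.

(** Both trees have the same number of leaves, so they are straightened to the
    same comb. *)
Lemma tree_pair_vine (f : thompsonF R) T S : maps_all f (leaves T) (leaves S) ->
  f = ((vine_map R 0 S)^-1 * vine_map R 0 T)%g.
Proof.
move=> TS; have id0 l : map (cat (ones 0)) l = l by apply: map_id.
have := @maps_vine R 0 T; have := @maps_vine R 0 S; rewrite !id0 => vS vT.
have := maps_all_size TS; rewrite !size_leaves => -[eW].
apply: eq_thompsonF_leaves TS _.
by apply: maps_all_mul vT _; rewrite eW; exact: maps_all_inv.
Qed.

End TreePairs.

Section Colored.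
Variable R : realType.
Implicit Types (u v w : seq bool) (f g h : thompsonF R).
Implicit Types (l : seq (seq bool)) (T A B : tree) (q : state).

Definition colored : set (thompsonF R) :=
  [set f | forall u v, maps f u v -> state_of u = state_of v].

Lemma maps_factor f g u v w : maps (f * g)%g u w -> maps g u v -> maps f v w.
Proof. by move=> m1 m2 x; rewrite -m2 -m1. Qed.

(** Where a product acts affinely its factors need not; they do on small enough
    subintervals, which suffices by [state_of_determined]. *)
Lemma colored_subgroup : subgroup colored.
Proof.
apply/subgroupP; split=> [u v m|f g fC gC u v m].
  by rewrite (maps_unique m (@maps_id _ u)).
have [n nP] := thompsonF_subdivision g^-1%g.
apply: (@state_of_determined n) => w wn.
have [|z m1] := nP (u ++ w); first by rewrite size_cat wn leq_addl.
have := maps_inv m1; rewrite invgK => m2.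
by rewrite -(gC _ _ m2); apply: fC; exact: maps_factor (maps_cat w m) m1.
Qed.

(** A small interval lies in a leaf, and its state depends only on that of the
    leaf. *)
Lemma colored_leaves f T l : maps_all f (leaves T) l ->
  map state_of (leaves T) = map state_of l ->
  [::] \notin leaves T -> [::] \notin l -> colored f.
Proof.
move=> fl e T0 l0 u v m; have [n nP] := leaves_prefix T.
apply: (@state_of_determined n) => w wn.
have [|t [z [tT uw]]] := nP (u ++ w); first by rewrite size_cat wn leq_addl.
have [t' [t'0 ft tt']] : exists t', [/\ t' != [::], maps f t t' & state_of t = state_of t'].
  elim: (leaves T) l fl e T0 l0 tT => [//|a s IH] [//|b s'] /= [mab c] [eab ess].
  rewrite !inE !negb_or => /andP[_ s0] /andP[b0 s'0] /orP[/eqP ->|ts].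
    by exists b; rewrite eq_sym.
  exact: IH c ess s0 s'0 ts.
have t0 : t != [::] by apply: contraNneq T0 => <-.
have -> : v ++ w = t' ++ z.
  by apply: maps_unique (maps_cat w m) _; rewrite uw; exact: maps_cat.
by rewrite uw /state_of !spine_state_cat // -/state_of tt'.
Qed.

Definition rotate_at (m : seq bool * bool) : thompsonF R :=
  emb m.1 (if m.2 then rotation R else (rotation R)^-1%g).

(** The last rotation of the list acts first, as in a product of maps. *)
Definition product_of (ms : seq (seq bool * bool)) : thompsonF R :=
  foldr (fun m f => rotate_at m * f)%g 1%g ms.

End Colored.

(** * Computing with products of rotations *)

(** The action of the rotation, or of its inverse, on words; it is undefined on
    the words whose intervals are not mapped affinely onto an interval of a
    word. Evaluating it verifies the action of concrete products. *)
Definition rotate_word (fwd : bool) (w : seq bool) : option (seq bool) :=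
  if fwd then
    match w with
    | false :: z => Some [:: false, false & z]
    | [:: true, false & z] => Some [:: false, true & z]
    | [:: true, true & z] => Some (true :: z)
    | _ => None
    end
  else
    match w with
    | [:: false, false & z] => Some (false :: z)
    | [:: false, true & z] => Some [:: true, false & z]
    | true :: z => Some [:: true, true & z]
    | _ => None
    end.

Fixpoint rotate_word_at (u : seq bool) fwd (w : seq bool) : option (seq bool) :=
  match u, w with
  | [::], _ => rotate_word fwd w
  | b :: u, c :: w =>
      if b == c then omap (cons c) (rotate_word_at u fwd w) else Some (c :: w)
  | _, _ => None
  end.

Definition move_word (ms : seq (seq bool * bool)) (w : seq bool) :=
  foldr (fun m o => obind (rotate_word_at m.1 m.2) o) (Some w) ms.

Section Moves.
Variable R : realType.
Implicit Types (u v w : seq bool) (f g h : thompsonF R).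
Implicit Types (l : seq (seq bool)) (T A B : tree) (q : state).

Lemma maps_rotate_word fwd w w' : rotate_word fwd w = Some w' ->
  maps (if fwd then rotation R else (rotation R)^-1%g) w w'.
Proof.
have m0 := @maps_rotation0 R; have m10 := @maps_rotation10 R.
have m11 := @maps_rotation11 R.
case: fwd; case: w => [|[] w] //=.
- case: w => [|[] w] //= [<-].
    exact: (maps_cat w m11).
  exact: (maps_cat w m10).
- by move=> [<-]; exact: (maps_cat w m0).
- by move=> [<-]; exact: (maps_cat w (maps_inv m11)).
case: w => [|[] w] //= [<-].
  exact: (maps_cat w (maps_inv m10)).
exact: (maps_cat w (maps_inv m0)).
Qed.

Lemma maps_rotate_at m w w' :
  rotate_word_at m.1 m.2 w = Some w' -> maps (rotate_at R m) w w'.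
Proof.
case: m => u fwd; rewrite /rotate_at /=.
elim: u w w' => [|b u IH] [|c w] w' //; try exact: maps_rotate_word.
rewrite [rotate_word_at _ _ _]/=; case: eqP => [<-|/eqP bc].
  case e : (rotate_word_at u fwd w) => [z|] //= [<-].
  exact: (maps_emb [:: b] (IH _ _ e)).
by move=> [<-]; apply: maps_emb_diverge; rewrite /= bc.
Qed.

Lemma maps_product_of ms w w' :
  move_word ms w = Some w' -> maps (product_of R ms) w w'.
Proof.
elim: ms w w' => [|m ms IH] w w' /=; first by move=> [<-]; exact: maps_id.
case e : (move_word ms w) => [z|] //= mz.
by apply: maps_mul (IH _ _ e) _; exact: maps_rotate_at.
Qed.

Lemma maps_all_product_of ms l l' :
  map (move_word ms) l = map Some l' -> maps_all (product_of R ms) l l'.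
Proof.
elim: l l' => [|w l IH] [|w' l'] //= [e /IH c]; split=> //.
exact: maps_product_of.
Qed.

Lemma emb_product_of u ms :
  emb u (product_of R ms) = product_of R [seq (u ++ m.1, m.2) | m <- ms].
Proof.
elim: ms => [|m ms IH] /=; first exact: emb1.
by rewrite embM IH /rotate_at /= emb_cat.
Qed.

End Moves.

(** * Recolouring and the three generators *)

Section Recoloring.
Variable R : realType.
Implicit Types (u v w : seq bool) (f g h : thompsonF R).
Implicit Types (l : seq (seq bool)) (T A B : tree) (q : state).

(** The states that can occur at position [k]: only the first interval of a
    comb starts at 0. *)
Definition allowed k q : Prop := if k is 0 then q = Sl else q <> Sl.

(** Colour-preserving maps from an interval of state [q] to the same interval
    with state a. For b this is the rotation, as b -> (a, (b, b)) and
    a -> ((a, b), b); for c the left half is recoloured, as c -> (b, b) and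
    a -> (a, b). The state l occurs only at position 0 and is kept. *)
Definition to_a q : thompsonF R := match q with
  | Sb => rotation R
  | Sc => emb [:: false] (rotation R)
  | _ => 1%g
  end.

(** The subdivision of an interval of state [q] at position [k], seen after all
    the intervals involved have been recoloured a. *)
Definition split_state q k : thompsonF R :=
  (emb (spine k) (to_a (child q false)) * emb (spine k.+1) (to_a (child q true)) *
   split_at R k * (emb (spine k) (to_a q))^-1)%g.

Fixpoint comb_to_a k (s : seq state) : thompsonF R :=
  if s is q :: s then (emb (spine k) (to_a q) * comb_to_a k.+1 s)%g else 1%g.

Lemma comb_to_a_cat k s1 s2 :
  comb_to_a k (s1 ++ s2) = (comb_to_a k s1 * comb_to_a (k + size s1) s2)%g.
Proof.
elim: s1 k => [|q s IH] k /=; first by rewrite addn0 mul1g.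
by rewrite IH mulgA addnS.
Qed.

Lemma diverge_spines j k : j != k -> diverge (spine k) (spine j).
Proof.
elim: j k => [|j IH] [|k] // jk.
rewrite -[diverge _ _]/(diverge (spine k) (spine j)).
by apply: IH; apply: contra_neq jk => ->.
Qed.

Lemma conj_comb_to_a h k k' s : maps h (ones k) (ones k') ->
  (h * comb_to_a k s = comb_to_a k' s * h)%g.
Proof.
elim: s k k' => [|q s IH] k k' m /=; first by rewrite mulg1 mul1g.
rewrite mulgA (@conj_emb _ h (spine k) (spine k')); last first.
  by rewrite /spine -!cats1; exact: maps_cat m.
rewrite -mulgA (IH k.+1 k'.+1) ?mulgA //.
by rewrite -[k.+1]addn1 -[k'.+1]addn1 -!ones_cat; exact: maps_cat m.
Qed.

Lemma comb_to_a_commute h k s :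
  (forall j, (j < k + size s)%N -> maps h (spine j) (spine j)) ->
  (h * comb_to_a k s = comb_to_a k s * h)%g.
Proof.
elim: s k => [|q s IH] k m /=; first by rewrite mulg1 mul1g.
rewrite mulgA (conj_emb _ (m k _)); last by rewrite /=; lia.
rewrite -!mulgA IH // => j jk; apply: m; rewrite /=; lia.
Qed.

Lemma maps_comb_to_a_before j k s : (j < k)%N -> maps (comb_to_a k s) (spine j) (spine j).
Proof.
elim: s k => [|q s IH] k jk /=; first exact: maps_id.
apply: maps_mul (IH k.+1 _) _; first exact: ltnW.
by apply: maps_emb_diverge; apply: diverge_spines; rewrite ltn_eqF.
Qed.

Lemma split_state_root : split_state Sl 0 = split_at R 0.
Proof. by rewrite /split_state /= !emb1 invg1 !mul1g mulg1. Qed.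

(** The recolouring of c is that of its left half, which commutes past the
    subdivision and cancels. *)
Lemma split_state_c k : split_state Sc k = split_state Sa k.
Proof.
rewrite /split_state /= !emb1 invg1 mulg1 mul1g -!mulgA.
rewrite -emb_cat.
rewrite (_ : spine k ++ [:: false] = rcons (spine k) false) ?cats1 //.
have e := conj_emb (rotation R) (@maps_split_left R k).
have c : (emb (spine k.+1) (rotation R) * emb (spine k) (rotation R) =
          emb (spine k) (rotation R) * emb (spine k.+1) (rotation R))%g.
  by apply: conj_emb; apply: maps_emb_diverge; apply: diverge_spines; lia.
by rewrite mulgA -c -mulgA (mulgA _ (split_at R k)) -e mulgK.
Qed.

Definition generators : 3.-tuple (thompsonF R) :=
  [tuple split_state Sl 0; split_state Sa 1; split_state Sb 1].

End Recoloring.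

Section GeneratorsAsProducts.
Variable R : realType.

Lemma split_state_root_product : split_state R Sl 0 = product_of R [:: ([::], false)].
Proof. by rewrite split_state_root /= mulg1. Qed.

Lemma split_state_a_product :
  split_state R Sa 1 = product_of R [:: (spine 2, true); ([:: true], false)].
Proof. by rewrite /split_state /= !emb1 invg1 !mulg1 mul1g. Qed.

Lemma split_state_b_product : split_state R Sb 1 =
  product_of R [:: (rcons (spine 2) false, true); ([:: true], false); (spine 1, false)].
Proof.
by rewrite /split_state /= !emb1 mul1g -emb_cat cats1 -embV mulg1 -mulgA.
Qed.

Lemma colored_product ms T l : map (move_word ms) (leaves T) = map Some l ->
  map state_of (leaves T) = map state_of l ->
  [::] \notin leaves T -> [::] \notin l -> colored (product_of R ms).
Proof. by move=> /(@maps_all_product_of R); exact: colored_leaves. Qed.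

Lemma colored_split_root : colored (split_state R Sl 0).
Proof.
rewrite split_state_root_product.
by apply: (@colored_product _ (Node (Node Leaf Leaf) Leaf)
  [:: [:: false]; [:: true; false]; [:: true; true]]).
Qed.

Lemma colored_split_a : colored (split_state R Sa 1).
Proof.
rewrite split_state_a_product.
by apply: (@colored_product _
  (Node Leaf (Node (Node Leaf (Node Leaf (Node Leaf Leaf))) Leaf))
  [:: [:: false]; [:: true; false]; [:: true; true; false; false; false];
      [:: true; true; false; false; true]; [:: true; true; false; true];
      [:: true; true; true]]).
Qed.

Lemma colored_split_b : colored (split_state R Sb 1).
Proof.
rewrite split_state_b_product.
by apply: (@colored_product _
  (Node Leaf (Node (Node (Node Leaf (Node Leaf (Node Leaf Leaf))) Leaf) Leaf))
  [:: [:: false]; [:: true; false]; [:: true; true; false; false; false; false];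
      [:: true; true; false; false; false; true]; [:: true; true; false; false; true];
      [:: true; true; false; true]; [:: true; true; true]]).
Qed.

(** The rebracketing x((yz)(uv)) -> (x(y(zu)))v. *)
Definition law_a : seq (seq bool * bool) :=
  [:: ([::], true); ([:: true], true); ([:: true; true], true); ([:: true], false)].

(** The rebracketing x(((yz)(uv))w) -> (x(y(zu)))(vw). *)
Definition law_b : seq (seq bool * bool) :=
  [:: ([:: false; true], false); ([:: false], false); ([::], true);
      ([:: true], false); ([::], true); ([:: true], false)].

(** The interval 10 has state a, and halving an interval of state a according to
    the two bracketings produces the same list of states. *)
Lemma colored_law_a : colored (emb [:: true; false] (product_of R law_a)).
Proof.
rewrite emb_product_of.
by apply: (@colored_product _
  (Node Leaf (Node (Node Leaf (Node (Node Leaf Leaf) (Node Leaf Leaf))) Leaf))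
  ([:: false] :: map (cat [:: true; false])
   [:: [:: false; false]; [:: false; true; false]; [:: false; true; true; false];
       [:: false; true; true; true]; [:: true]] ++ [:: [:: true; true]])).
Qed.

(** The interval 101 has state b, for which the two bracketings of [law_b]
    produce the same list of states. *)
Lemma colored_law_b : colored (emb [:: true; false; true] (product_of R law_b)).
Proof.
rewrite emb_product_of.
by apply: (@colored_product _
  (Node Leaf (Node (Node Leaf
     (Node Leaf (Node (Node (Node Leaf Leaf) (Node Leaf Leaf)) Leaf))) Leaf))
  ([:: false] :: [:: true; false; false] :: map (cat [:: true; false; true])
   [:: [:: false; false]; [:: false; true; false]; [:: false; true; true; false];
       [:: false; true; true; true]; [:: true; false]; [:: true; true]]
   ++ [:: [:: true; true]])).
Qed.

(** From x(((yz)((uv)w))t), [law_b] gives (x(y(z(uv))))(wt), the inverse of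
    [law_a] gives x((yz)((uv)(wt))), and [law_a] on the right half gives
    x(((yz)(u(vw)))t). In total ((uv)w) has been rebracketed to (u(vw)). *)
Lemma laws_give_rotation :
  (emb [:: true] (product_of R law_a) * (product_of R law_a)^-1 * product_of R law_b =
   emb [:: true; false; true] (rotation R)^-1)%g.
Proof.
set T := Node Leaf (Node (Node (Node Leaf Leaf) (Node (Node Leaf Leaf) Leaf)) Leaf).
pose l1 := [:: [:: false; false]; [:: false; true; false];
  [:: false; true; true; false]; [:: false; true; true; true; false];
  [:: false; true; true; true; true]; [:: true; false]; [:: true; true]].
pose l2 := [:: [:: false]; [:: true; false; false]; [:: true; false; true];
  [:: true; true; false; false]; [:: true; true; false; true];
  [:: true; true; true; false]; [:: true; true; true; true]].
pose l3 := [:: [:: false]; [:: true; false; false; false]; [:: true; false; false; true];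
  [:: true; false; true; false]; [:: true; false; true; true; false];
  [:: true; false; true; true; true]; [:: true; true]].
have b1 : maps_all (product_of R law_b) (leaves T) l1 by exact: maps_all_product_of.
have a1 : maps_all (product_of R law_a) l2 l1 by exact: maps_all_product_of.
have a3 : maps_all (emb [:: true] (product_of R law_a)) l2 l3.
  by rewrite emb_product_of; exact: maps_all_product_of.
apply: (@eq_thompsonF_leaves _ T _ _ l3).
  exact: maps_all_mul b1 (maps_all_mul (maps_all_inv a1) a3).
have -> : (emb [:: true; false; true] (rotation R)^-1 =
           product_of R [:: ([:: true; false; true], false)])%g by rewrite /= mulg1.
exact: maps_all_product_of.
Qed.

End GeneratorsAsProducts.

(** * Subgroups containing the three generators *)

Section Subgroups.
Variable R : realType.
Implicit Types (x y : I01 R) (b : bool) (u v w : seq bool) (f g h : thompsonF R).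
Implicit Types (q p : state) (T A B : tree).

Variable K : set (thompsonF R).
Hypothesis subK : subgroup K.
Hypothesis genK : [set` generators R] `<=` K.

Let K_root : K (split_state R Sl 0).
Proof. by apply: genK; rewrite /= !inE eqxx. Qed.

Let K_a : K (split_state R Sa 1).
Proof. by apply: genK; rewrite /= !inE eqxx orbT. Qed.

Let K_b : K (split_state R Sb 1).
Proof. by apply: genK; rewrite /= !inE eqxx !orbT. Qed.

Let K1 : K 1%g. Proof. by case/subgroupP: subK. Qed.

Let KV f : K f -> K f^-1%g.
Proof. by case/subgroupP: subK => _ KB /(KB _ _ K1); rewrite mul1g. Qed.

Let KM f g : K f -> K g -> K (f * g)%g.
Proof. by case/subgroupP: subK => _ KB Kf /KV /(KB _ _ Kf); rewrite invgK. Qed.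

(** Conjugation by the shift [split_at R 0] raises [k] by one for [k > 0]. *)
Lemma K_split_state k q : allowed k q -> K (split_state R q k).
Proof.
case: k => [->//|k]; rewrite /allowed => q0.
elim: k => [|k IH].
  by case: q q0 => // _; rewrite split_state_c.
have m1 : maps (split_at R 0) (ones k.+1) (ones k.+2).
  by have := maps_cat (ones k) (@maps_split_tail R 0); rewrite !ones_cat add1n add2n.
have m2 : maps (split_at R 0) (ones k.+2) (ones k.+3).
  by have := maps_cat (ones k.+1) (@maps_split_tail R 0); rewrite !ones_cat add1n add2n.
have n1 : maps (split_at R 0) (spine k.+1) (spine k.+2).
  by rewrite /spine -!cats1; exact: maps_cat m1.
have n2 : maps (split_at R 0) (spine k.+2) (spine k.+3).
  by rewrite /spine -!cats1; exact: maps_cat m2.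
have -> : split_state R q k.+2 = (split_at R 0 * split_state R q k.+1 * (split_at R 0)^-1)%g.
  apply: (mulIg (split_at R 0)); rewrite mulgVK /split_state -!embV -!mulgA.
  rewrite -(conj_emb _ n1) !mulgA.
  rewrite (conj_emb _ n1) -!mulgA; congr (_ * _)%g; rewrite !mulgA.
  rewrite (conj_emb _ n2) -!mulgA; congr (_ * _)%g; rewrite !mulgA.
  by rewrite (conj_emb _ m1).
by rewrite -split_state_root; apply: KM (KV K_root); exact: KM K_root IH.
Qed.

(** Induction on the tree, inserting the recolourings between the elementary
    subdivisions. The part coming from the right subtree acts on later positions
    only and so commutes with the recolouring at position [k]. *)
Lemma K_comb k q A : allowed k q ->
  K (comb_to_a R k (colors q A) * comb_map R k A * (emb (spine k) (to_a R q))^-1)%g.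
Proof.
elim: A k q => [|A IHA B IHB] k q kq /=; first by rewrite !mulg1 mulgV.
have q0 : allowed k (child q false).
  by case: k kq => [->//|k]; case: q.
have q1 : child q true <> Sl by case: q {kq q0}.
have := IHB k.+1 (child q true) q1; set h2 := (_ * _)%g => Kh2.
have := IHA k (child q false) q0; set h1 := (_ * _)%g => Kh1.
rewrite comb_to_a_cat size_colors.
have e := conj_comb_to_a (colors (child q true) B) (@maps_comb_tail R k A).
have eh1 : (comb_to_a R k (colors (child q false) A) * comb_map R k A =
            h1 * emb (spine k) (to_a R (child q false)))%g by rewrite /h1 mulgVK.
have eh2 : (comb_to_a R k.+1 (colors (child q true) B) * comb_map R k.+1 B =
            h2 * emb (spine k.+1) (to_a R (child q true)))%g by rewrite /h2 mulgVK.
have h2k : maps h2 (spine k) (spine k).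
  apply: maps_mul (maps_mul (maps_comb_before _ _) (maps_comb_to_a_before _ _)) => //.
  rewrite -embV; apply: maps_emb_diverge; apply: diverge_spines; lia.
have eK : (comb_to_a R k (colors (child q false) A) *
    comb_to_a R (k + weight A) (colors (child q true) B) *
    (comb_map R k A * (comb_map R k.+1 B * split_at R k)) * (emb (spine k) (to_a R q))^-1 =
    h1 * h2 * split_state R q k)%g.
  have c := conj_emb (to_a R (child q false)) h2k.
  transitivity (comb_to_a R k (colors (child q false) A) * comb_map R k A *
      (comb_to_a R k.+1 (colors (child q true) B) * comb_map R k.+1 B) *
      split_at R k * (emb (spine k) (to_a R q))^-1)%g.
    by rewrite !mulgA -(mulgA _ (comb_to_a R (k + weight A) _)) -e !mulgA.
  by rewrite eh1 eh2 /split_state; clearbody h1 h2; rewrite !mulgA -(mulgA h1 _ h2) -c !mulgA.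
by rewrite eK; apply: KM (K_split_state kq); exact: KM.
Qed.

(** No recolouring is needed before straightening: the state at position [k] is
    l or a. *)
Lemma K_vine k T :
  K (comb_to_a R k (spine_colors (if k is 0 then Sl else Sa) T) * vine_map R k T)%g.
Proof.
elim: T k => [|A _ B IH] k /=; first by rewrite mulg1.
set q := if k is 0 then Sl else Sa.
rewrite comb_to_a_cat size_colors.
have := IH (k + weight A)%N; have -> : (if (k + weight A)%N is 0 then Sl else Sa) = Sa.
  have : (0 < weight A)%N by elim: A => //= A IHA B' _; rewrite ltn_addr.
  by case: (weight A) => // n _; rewrite addnS.
set h := (_ * _)%g => Kh.
have c : (h * comb_to_a R k (colors q A) = comb_to_a R k (colors q A) * h)%g.
  apply: comb_to_a_commute => j; rewrite size_colors => jk.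
  exact: maps_mul (maps_vine_before _ jk) (maps_comb_to_a_before _ jk).
have := @K_comb k q A; have -> : to_a R q = 1%g by rewrite /q; case: (k).
rewrite emb1 invg1 mulg1 => Kc.
have -> : (comb_to_a R k (colors q A) * comb_to_a R (k + weight A) (spine_colors Sa B) *
    (vine_map R (k + weight A) B * comb_map R k A) =
    h * (comb_to_a R k (colors q A) * comb_map R k A))%g.
  by rewrite [RHS]mulgA c /h !mulgA.
by apply: KM Kh _; apply: Kc; rewrite /q; case: (k).
Qed.

(** If [f] matches the leaves of [T] with those of [S] and preserves states, both
    trees have the same list of states. Their straightenings are therefore
    followed by the same recolourings, which cancel in [f]. *)
Theorem colored_generated : @colored R `<=` K.
Proof.
move=> f fC; have [T [S TS]] := tree_pair f.
have eC : spine_colors Sl T = spine_colors Sl S.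
  have : map state_of (leaves T) = map state_of (leaves S).
    elim: (leaves T) (leaves S) TS => [|u l IH] [|v l'] //= [m /IH ->].
    by rewrite (fC _ _ m).
  rewrite /state_of !leaves_spine_state => /rcons_inj[].
  by apply: inj_map => p p' [].
rewrite (tree_pair_vine TS).
have KT := K_vine 0 T; have KS := K_vine 0 S.
have -> : ((vine_map R 0 S)^-1 * vine_map R 0 T =
   (comb_to_a R 0 (spine_colors Sl S) * vine_map R 0 S)^-1 *
   (comb_to_a R 0 (spine_colors Sl T) * vine_map R 0 T))%g.
  by rewrite eC invgM -mulgA mulKg.
by apply: KM => //; exact: KV.
Qed.

Let s0 := split_at R 0.

Let Ks0 : K s0. Proof. by rewrite /s0 -split_state_root. Qed.

Lemma spine_state_None q u : spine_state q u = None -> u = ones (size u).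
Proof. by elim: u q => [|[] u IH] q //= /IH e; rewrite {1}e. Qed.

Lemma reach_spine k : exists2 h, K h & maps h (spine k.+1) (spine 1).
Proof.
elim: k => [|k [h Kh m]]; first by exists 1%g => //; exact: maps_id.
exists (h * s0^-1)%g; first exact: KM (KV Ks0).
apply: maps_mul m; apply: maps_inv.
by have := maps_cat (spine k) (@maps_split_tail R 0); rewrite !ones_spine add1n add2n.
Qed.

Lemma reach_left u : state_of u = Some Sl -> exists2 h, K h & maps h u [:: false].
Proof.
elim/last_ind: u => [//|u b IH]; rewrite /state_of spine_state_rcons.
case e : (spine_state Sl u) => [p|].
  case: p e => // e; case: b => // _; have [h Kh m] := IH e.
  exists (s0 * h)%g; first exact: KM.
  rewrite -cats1; apply: maps_mul (maps_cat _ m) _.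
  exact: (@maps_split_left R 0).
case: b => //; case: u e {IH} => [|c u] //= _ _.
by exists 1%g => //; exact: maps_id.
Qed.

(** Induction on the word. Once the interval of state [p] has been brought to 10
    and recoloured, [split_state p 1] expands its left half to 10 and its right
    half to 110, and the shift brings the latter back to 10. *)
Lemma reach_inner u q : q <> Sl -> state_of u = Some q ->
  exists2 h, K h & maps ((emb (spine 1) (to_a R q))^-1 * h)%g u (spine 1).
Proof.
have S10 : maps (split_at R 1) (rcons (spine 1) false) (spine 1) by exact: maps_split_left.
have S11 : maps (split_at R 1) (rcons (spine 1) true) (spine 2) by exact: maps_split_right.
have m01 : maps s0 (spine 1) (spine 2).
  by have := maps_cat (spine 0) (@maps_split_tail R 0); rewrite !ones_spine add1n add2n.
elim/last_ind: u q => [//|u b IH] q ql; rewrite /state_of spine_state_rcons.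
case e : (spine_state Sl u) => [p|]; last first.
  case: b => //; case: u e {IH} => [|c u] e [qE]; first by rewrite -qE in ql.
  rewrite (spine_state_None e) -qE /= emb1 invg1 /=.
  have [h Kh m] := reach_spine (size u); exists h => //; rewrite mul1g; exact: m.
move=> [qE]; have [pl|pl] := pselect (p = Sl).
  rewrite pl in e qE; case: b qE => /= qE; last by rewrite -qE in ql.
  have [h Kh m] := reach_left e; exists (s0 * h)%g; first exact: KM.
  rewrite -qE /= emb1 invg1 mul1g -cats1; apply: maps_mul (maps_cat _ m) _.
  exact: (@maps_split_right R 0).
have [h Kh m] := IH p pl e.
have Kp : K (split_state R p 1) by apply: K_split_state.
set kp := emb (spine 1) (to_a R p) in m.
pose k0 := emb (spine 1) (to_a R (child p false)).
pose k1 := emb (spine 2) (to_a R (child p true)).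
have E : split_state R p 1 = (k0 * k1 * split_at R 1 * kp^-1)%g by [].
move: (split_state R p 1) E Kp => P E Kp.
have fix1 : maps k1 (spine 1) (spine 1).
  by apply: maps_emb_diverge.
have fix0 : maps k0 (spine 2) (spine 2).
  by apply: maps_emb_diverge.
case: b qE => qE.
  exists (s0^-1 * (P * h))%g; first exact: KM (KV Ks0) (KM Kp Kh).
  have c := conj_emb (to_a R q) m01.
  have -> : ((emb (spine 1) (to_a R q))^-1 * (s0^-1 * (P * h)) =
             s0^-1 * k0 * (split_at R 1 * (kp^-1 * h)))%g.
    apply: (mulgI s0); apply: (mulgI (emb (spine 2) (to_a R q))).
    rewrite mulgA -c -!mulgA mulVKg mulVKg.
    have c' : (k0 * k1 = k1 * k0)%g by apply: conj_emb fix0.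
    by rewrite E c' /k1 qE -!mulgA mulVKg.
  rewrite -cats1; apply: maps_mul (maps_mul (maps_cat _ m) _) (maps_mul fix0 (maps_inv m01)).
  by rewrite cats1; exact: S11.
exists (P * h)%g; first exact: KM.
have -> : ((emb (spine 1) (to_a R q))^-1 * (P * h) =
           k1 * (split_at R 1 * (kp^-1 * h)))%g.
  by rewrite E /k0 qE -!mulgA mulKg.
rewrite -cats1; apply: maps_mul (maps_mul (maps_cat _ m) _) fix1.
by rewrite cats1; exact: S10.
Qed.

Definition joined u v : Prop := exists2 h, K h & maps h u v.

Lemma joined_sym u v : joined u v -> joined v u.
Proof. by move=> [h Kh m]; exists h^-1%g; [exact: KV | exact: maps_inv]. Qed.

Lemma joined_trans v u w : joined u v -> joined v w -> joined u w.
Proof. by move=> [h Kh m] [g Kg n]; exists (g * h)%g; [exact: KM | exact: maps_mul n]. Qed.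

Lemma joined_cat w u v : joined u v -> joined (u ++ w) (v ++ w).
Proof. by move=> [h Kh m]; exists h => //; exact: maps_cat. Qed.

(** Both intervals are carried to 10 with the same recolouring, which
    cancels. *)
Lemma joined_same_state u v q : q <> Sl -> state_of u = Some q -> state_of v = Some q ->
  joined u v.
Proof.
move=> ql /(reach_inner ql)[h Kh m] /(reach_inner ql)[g Kg n].
exists (g^-1 * h)%g; first exact: KM (KV Kg) Kh.
by have := maps_mul m (maps_inv n); rewrite invgM invgK -mulgA mulVKg.
Qed.

Definition word_in q : seq bool := match q with
  | Sl => [:: false]
  | Sa => [:: true; false]
  | Sb => [:: true; false; true]
  | Sc => [:: true; false; true; true]
  end.

Lemma state_of_word_in q : state_of (word_in q) = Some q.
Proof. by case: q. Qed.

Definition merged p q : Prop := joined (word_in p) (word_in q).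

Lemma merged_of p q u v : p <> Sl -> q <> Sl ->
  state_of u = Some p -> state_of v = Some q -> joined u v -> merged p q.
Proof.
move=> pl ql up vq uv; apply: joined_trans (joined_trans uv _).
  by apply: joined_same_state up; rewrite ?state_of_word_in.
by apply: joined_same_state vq _; rewrite ?state_of_word_in.
Qed.

Lemma merged_child b p q : p <> Sl -> q <> Sl -> merged p q ->
  merged (child p b) (child q b).
Proof.
move=> pl ql /(joined_cat [:: b]); apply: merged_of.
- by case: p pl; case: b.
- by case: q ql; case: b.
- by case: p pl; case: b.
- by case: q ql; case: b.
Qed.

(** Merging a with b merges b with c by right halves; merging a with c, or b with
    c, merges a with b by left halves. *)
Lemma merged_all p q : p <> Sl -> q <> Sl -> p <> q -> merged p q ->
  forall p' q', p' <> Sl -> q' <> Sl -> merged p' q'.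
Proof.
move=> pl ql pq m.
have ab_ok : merged Sa Sb -> forall p' q', p' <> Sl -> q' <> Sl -> merged p' q'.
  move=> ab; have bc : merged Sb Sc by exact: (@merged_child true Sa Sb).
  have ac : merged Sa Sc by exact: joined_trans ab bc.
  have rf r : merged r r by exists 1%g => //; exact: maps_id.
  by move=> [] [] // _ _; apply: joined_sym.
have bc_ok : merged Sb Sc -> merged Sa Sb by exact: (@merged_child false Sb Sc).
have ac_ok : merged Sa Sc -> merged Sa Sb by exact: (@merged_child false Sa Sc).
apply: ab_ok; case: p q pl ql pq m => -[] // _ _ _ m.
- exact: joined_sym.
- exact/ac_ok/joined_sym.
- exact/bc_ok/joined_sym.
Qed.

Lemma maps_state_None (k : thompsonF R) u v : maps k u v -> state_of u = None -> state_of v = None.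
Proof.
move=> m /spine_state_None uE; rewrite uE in m; rewrite (maps_ones m) /state_of.
by elim: (size v) Sl => //= n IH q; exact: (IH Sa).
Qed.

Lemma state_of_left u : state_of u = Some Sl -> exists n, u = nseq n.+1 false.
Proof.
rewrite /state_of; elim/last_ind: u => [//|u b IH]; rewrite spine_state_rcons.
case e : (spine_state Sl u) => [r|].
  case: r e; case: b => // /IH[n ->] _; exists n.+1.
  by rewrite -cats1 -[[:: false]]/(nseq 1 false) -nseqD addn1.
by case: b => //; case: u {e IH} => [_|c u] //; exists 0%N.
Qed.

Lemma maps_state_left (k : thompsonF R) u v :
  maps k u v -> state_of u = Some Sl -> state_of v = Some Sl.
Proof.
move=> m /state_of_left[n uE]; rewrite uE in m.
rewrite (maps_zeros m); case: v m => [/maps_nil //|c v] _.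
by rewrite /state_of /=; congr Some; elim: (size v) => //= l ->.
Qed.

(** Elements of F fix 0 and 1, so only inner states can be confused. *)
Lemma maps_inner_state (k : thompsonF R) u v : maps k u v -> state_of u <> state_of v ->
  exists p q, [/\ p <> Sl, q <> Sl, p <> q, state_of u = Some p & state_of v = Some q].
Proof.
move=> m uv; have m' := maps_inv m.
case eu : (state_of u) uv => [p|] uv; last by case: uv; rewrite (maps_state_None m).
case ev : (state_of v) uv => [q|] uv; last first.
  by case: uv; rewrite -eu (maps_state_None m').
exists p, q; split=> // [pl|ql|pq]; apply: uv; last by rewrite pq.
  by rewrite -ev (maps_state_left m) ?eu ?pl.
by rewrite -eu (maps_state_left m') ?ev ?ql.
Qed.

(** [K] carries some interval to one of another state, so it merges all inner
    states, and intervals of equal state are joined already. *)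
Lemma joined_inner k : K k -> ~ colored k -> forall u v p q, p <> Sl -> q <> Sl ->
  state_of u = Some p -> state_of v = Some q -> joined u v.
Proof.
move=> Kk /existsNP[u0 /existsNP[v0 /not_implyP[m uv]]].
have [p0 [q0 [p0l q0l pq u0p v0q]]] := maps_inner_state m uv.
have all_merged : forall p q, p <> Sl -> q <> Sl -> merged p q.
  apply: (merged_all p0l q0l pq).
  by apply: (merged_of p0l q0l u0p v0q); exists k.
move=> u v p q pl ql up vq.
apply: joined_trans (joined_same_state pl up (state_of_word_in p)) _.
apply: joined_trans (all_merged p q pl ql) _.
exact: joined_same_state ql (state_of_word_in q) vq.
Qed.

Lemma K_emb u v g : joined u v -> K (emb u g) -> K (emb v g).
Proof.
move=> [h Kh m] Ku; have -> : emb v g = (h * emb u g * h^-1)%g.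
  by rewrite (conj_emb _ m) mulgK.
exact: KM (KM Kh Ku) (KV Kh).
Qed.

Lemma K_split_at k : K (split_at R 1) -> K (split_at R k).
Proof.
move=> Ks1; case: k => [//|]; elim=> [//|k IH].
have m : maps s0 (ones k.+1) (ones k.+2).
  by have := maps_cat (ones k) (@maps_split_tail R 0); rewrite !ones_cat add1n add2n.
have -> : split_at R k.+2 = (s0 * split_at R k.+1 * s0^-1)%g.
  by rewrite (conj_emb _ m) mulgK.
exact: KM (KM Ks0 IH) (KV Ks0).
Qed.

(** The straightening maps of trees are products of elementary subdivisions,
    which are the conjugates of those at positions 0 and 1. *)
Lemma K_full : K (split_at R 1) -> K = setT.
Proof.
move=> Ks1; apply/seteqP; split=> // f _.
have Kc k A : K (comb_map R k A).
  by elim: A k => //= A IHA B IHB k; apply: KM => //; apply: KM => //; exact: K_split_at.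
have Kv k T : K (vine_map R k T) by elim: T k => //= A _ B IHB k; exact: KM.
have [T [S TS]] := tree_pair f; rewrite (tree_pair_vine TS).
exact: KM (KV (Kv _ _)) (Kv _ _).
Qed.

(** Conjugation inside [K] makes both laws act on every inner interval. On the
    interval 10 they give a rotation in an inner interval, which conjugation
    carries to 110, where it cancels the recolouring in [split_state Sa 1]. *)
Lemma colored_maximal k : K k -> ~ colored k -> K = setT.
Proof.
move=> Kk kC; have J := joined_inner Kk kC; apply: K_full.
have Kla u p : p <> Sl -> state_of u = Some p -> K (emb u (product_of R law_a)).
  move=> pl up; apply: (@K_emb [:: true; false]); last exact/colored_generated/colored_law_a.
  exact: (J _ _ Sa p).
have Klb u p : p <> Sl -> state_of u = Some p -> K (emb u (product_of R law_b)).
  move=> pl up; apply: (@K_emb [:: true; false; true]).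
    exact: (J _ _ Sb p).
  exact/colored_generated/colored_law_b.
have Kr : K (emb [:: true; false; true; false; true] (rotation R)).
  move: Kla Klb (laws_give_rotation R).
  move: (product_of R law_a) (product_of R law_b) => la lb Kla Klb.
  move=> /(congr1 (emb [:: true; false])).
  rewrite !embM !embV -!emb_cat [_ ++ [:: true]]/= [X in emb X (rotation R)]/= => e.
  rewrite -[emb _ (rotation R)]invgK -e; apply/KV/KM; first apply/KM.
  - exact: (Kla _ Sb).
  - by apply/KV; exact: (Kla _ Sa).
  - exact: (Klb _ Sa).
have Kr2 : K (emb (spine 2) (rotation R)).
  by apply: K_emb Kr; exact: (J _ _ Sb Sa).
have -> : split_at R 1 = ((emb (spine 2) (rotation R))^-1 * split_state R Sa 1)%g.
  by rewrite split_state_a_product /= mulg1 mulKg.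
exact: KM (KV Kr2) K_a.
Qed.

Definition middle : I01 R := halve true (zeroI R).

(** Doubling repeatedly, a dyadic fraction reaches 1/2. *)
Lemma dyadic_middle x : dyadic_fractions x -> exists u, x = cone u middle.
Proof.
move=> [[m [n xE]] x01]; elim: n m x xE x01 => [|n IH] m x xE x01.
  move: x01; rewrite xE expr0 divr1 ltr0z ltrz1; lia.
(* 1/2 itself is the middle for the empty word; otherwise [x] is doubled modulo 1 *)
have [x2|x2] := eqVneq (\val x) (1/2).
  by exists [::]; apply: val_inj; rewrite /= x2 addr0.
have [b [y yE]] := halve_surj x; have /= yP := I01P y.
have /= e := congr1 \val yE; rewrite /= in x2 x01 xE.
have y0 : sval y != 0.
  apply/negP => /eqP y0; case/negP: x2; apply/eqP; rewrite y0 in e.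
  by clear yE; case: b e => /= e; lra.
have y1 : sval y != 1.
  apply/negP => /eqP y1; case/negP: x2; apply/eqP; rewrite y1 in e.
  by clear yE; case: b e => /= e; lra.
have y01 : 0 < \val y < 1.
  by rewrite !lt_neqAle eq_sym y0 y1; case/andP: yP => -> ->.
have [|u uE] := IH (m - (b : nat)%:Z * 2 ^+ n) y _ y01.
  rewrite rmorphB rmorphM rmorphXn /= mulrBl mulfK ?expf_neq0 //.
  move: e; rewrite xE exprS invfM mulrCA; move: (_ / 2 ^+ n) => r; lra.
by exists (b :: u); rewrite yE uE.
Qed.

Lemma reach_ones k : exists2 h, K h & h (cone (ones k.+1) middle) = cone [:: true] middle.
Proof.
elim: k => [|k [h Kh hE]]; first by exists 1%g.
exists (h * s0^-1)%g; first exact: KM (KV Ks0).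
have m : maps s0 (ones k.+1) (ones k.+2).
  by have := maps_cat (ones k) (@maps_split_tail R 0); rewrite !ones_cat add1n add2n.
by rewrite -[LHS]/(h (s0^-1%g (cone (ones k.+2) middle))) (maps_inv m).
Qed.

(** Write [x] as the middle of an interval. Inner intervals are carried to 10,
    with middle 5/8, up to a recolouring. The recolouring fixes the middle except
    in state b, where it moves 1/2 to 1/4, the middle of an interval of state a. *)
Lemma to_middle x : dyadic_fractions x -> exists2 h, K h & h x = middle.
Proof.
move=> /dyadic_middle[u ->].
have s_left : s0 (cone [:: false] middle) = middle.
  transitivity (cone (spine 1) (zeroI R)); first exact: (@maps_split_right R 0 (zeroI R)).
  by rewrite -[LHS]/(halve true (halve false (zeroI R))) halve00.
have s_right : s0 middle = cone [:: true] middle.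
  exact: (@maps_split_tail R 0 (zeroI R)).
have s_inner : split_state R Sa 1 (cone (spine 1) middle) = cone [:: true] middle.
  transitivity (rotate_at R (spine 2, true) (split_at R 1 (cone (spine 1) middle))).
    by rewrite split_state_a_product.
  rewrite (_ : split_at R 1 _ = cone (spine 2) (zeroI R)).
    rewrite /rotate_at emb_cone thompsonF0.
    by rewrite -[LHS]/(halve true (halve true (halve false (zeroI R)))) halve00.
  exact: (@maps_split_right R 1 (zeroI R)).
have from_right v : (exists2 h, K h & h (cone v middle) = cone [:: true] middle) ->
    exists2 h, K h & h (cone v middle) = middle.
  move=> [h Kh hE]; exists (s0^-1 * h)%g; first exact: KM (KV Ks0) Kh.
  by rewrite thompsonF_mulE /= hE -s_right; exact: thompsonF_funK.
have from_a v : (exists2 h, K h & h (cone v middle) = cone (spine 1) middle) ->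
    exists2 h, K h & h (cone v middle) = middle.
  move=> [h Kh hE]; apply: from_right; exists (split_state R Sa 1 * h)%g; first exact: KM.
  by rewrite thompsonF_mulE /= hE.
have state_a v : state_of v = Some Sa ->
    exists2 h, K h & h (cone v middle) = cone (spine 1) middle.
  move=> va; have [h Kh m] := reach_inner (ltac:(by []) : Sa <> Sl) va.
  by exists h => //; move: m; rewrite /= emb1 invg1 mul1g.
case e : (state_of u) => [q|]; last first.
  rewrite (spine_state_None e); case: (size u) => [|k]; first by exists 1%g.
  by apply: from_right; exact: reach_ones.
have [ql|ql] := pselect (q = Sl).
  rewrite ql in e; have [h Kh m] := reach_left e.
  exists (s0 * h)%g; first exact: KM.
  by rewrite thompsonF_mulE /= m.
have [h Kh m] := reach_inner ql e.
have hE : h (cone u middle) = cone (spine 1) (to_a R q middle).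
  rewrite -emb_cone -m -[RHS]/((_ * (_ * h))%g (cone u middle)).
  by rewrite mulVKg.
case: q ql e m hE => // _ e m hE.
- by apply: from_a; exists h.
- have [|g Kg gE] := state_a (rcons (spine 1) false); first by [].
  apply: from_a; exists (g * h)%g; first exact: KM.
  rewrite -[LHS]/(g (h (cone u middle))) hE -gE; congr (g _).
  rewrite -cats1 cone_cat; congr cone.
  transitivity (cone [:: false; true] (zeroI R)); last by [].
  by rewrite -(@maps_rotation10 R) /= halve00.
- apply: from_a; exists h => //; rewrite hE; congr cone.
  rewrite /middle -halve01 -[halve false _]/(cone [:: false] (oneI R)) emb_cone.
  by rewrite thompsonF1.
Qed.

End Subgroups.

(** * The maximal subgroup *)

Section Conclusion.
Variable R : realType.

Lemma colored_generators : [set` generators R] `<=` @colored R.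
Proof.
move=> g; rewrite /= !inE => /or3P[] /eqP ->.
- exact: colored_split_root.
- exact: colored_split_a.
- exact: colored_split_b.
Qed.

Lemma colored_3_generated : n_generated 3 (@colored R).
Proof.
exists (generators R); apply/seteqP; split=> [f fC K [subK genK]|f].
  exact: (colored_generated subK genK).
by apply; split; [exact: colored_subgroup | exact: colored_generators].
Qed.

Lemma colored_transitive : acts_transitively_on (@colored R) (@dyadic_fractions R).
Proof.
move=> x xD; have subC := @colored_subgroup R.
have toM := to_middle subC colored_generators.
apply/seteqP; split=> [_ [h _ <-]|y yD].
  exact/(thompsonF_dyadic_fractions _ (thompsonFP h)).
have [g gC gx] := toM x xD; have [h hC hy] := toM y yD.
have [C1 CB] := (subgroupP _).1 subC.
exists (h^-1 * g)%g; last first.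
  by rewrite -[LHS]/(h^-1%g (g x)) gx -hy; exact: thompsonF_funK.
have := CB _ _ C1 hC; rewrite mul1g => hV; have := CB _ _ C1 gC; rewrite mul1g => gV.
by have := CB _ _ hV gV; rewrite invgK.
Qed.

Lemma state_of_spine_cat n w : state_of (spine n.+1 ++ w) = Some (run Sa w).
Proof.
have tail k : spine_state Sa (spine k ++ w) = Some (run Sa w) by elim: k.
exact: (tail n).
Qed.

Lemma spine_rotation_not_colored n (h : thompsonF R) :
  maps h (spine n.+1 ++ [:: true; false]) (spine n.+1 ++ [:: false; true]) -> ~ colored h.
Proof. by move=> m /(_ _ _ m); rewrite !state_of_spine_cat. Qed.

Lemma colored_proper : @colored R `<` setT.
Proof.
split=> // /(_ (emb (spine 1) (rotation R)) I).
exact/(@spine_rotation_not_colored 0)/maps_emb/maps_rotation10.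
Qed.

(** The rotations inside the disjoint intervals 10, 110, 1110, and so on, of
    state a, are not colour-preserving, and a quotient of two of them still acts on each of the
    two intervals as a rotation or its inverse. *)
Lemma colored_infinite_index : infinite_index (@colored R).
Proof.
pose y n : thompsonF R := emb (spine n.+1) (rotation R).
pose F n := left_coset (y n) (@colored R).
have [C1 _] := (subgroupP _).1 (@colored_subgroup R).
have F_inj : injective F.
  move=> m n FE; have : F m (y m) by exists 1%g; rewrite ?mulg1.
  rewrite FE => -[h hC hE]; apply/eqP; apply/negPn/negP => mn.
  apply: (@spine_rotation_not_colored m h) hC.
  have -> : h = ((y n)^-1 * y m)%g by rewrite -hE mulKg.
  apply: maps_mul (maps_emb _ (@maps_rotation10 R)) (maps_inv _).
  by apply/maps_cat/maps_emb_diverge/diverge_spines; rewrite eqSS.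
move=> finF; apply: infinite_nat.
have -> : [set: nat] = F @^-1` range (fun g : thompsonF R => left_coset g (@colored R)).
  by apply/seteqP; split=> // n _; exists (y n).
by apply: finite_preimage finF => m n _ _; exact: F_inj.
Qed.

End Conclusion.

Theorem theorem1p6 (R : realType) :
  exists H : set (thompsonF R),
    [/\ n_generated 3 H, maximal_subgroup H, infinite_index H &
        acts_transitively_on H (@dyadic_fractions R)].
Proof.
exists (@colored R); split.
- exact: colored_3_generated.
- split; [exact: colored_subgroup | exact: colored_proper |] => K subK CK.
  have [KC|/existsNP[k /not_implyP[Kk kC]]] := pselect (K `<=` @colored R).
    by left; apply/seteqP.
  right; apply: (colored_maximal subK _ Kk kC).
  by move=> g /colored_generators; exact: CK.
- exact: colored_infinite_index.
- exact: colored_transitive.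
Qed.
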